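(* Let $G$ be a group. Then $G$ is linearly parametrizable if and only if $G$ is (2-ended)-2-decomposable and balanced.
   Context: Graphs of groups have finite connected underlying graph and injective edge maps. $\mathbb D_\infty$ is the infinite dihedral group. A graph of groups $\mathcal G$ is linearly parametrizable if there is a homomorphism $\Phi\colon\pi_1(\mathcal G)\to\mathbb D_\infty$ such that for each vertex or edge group $G_u$ the restriction $\Phi|_{G_u}\colon G_u\to\mathbb D_\infty$ is a quasi-isometry (equivalently, has finite kernel and finite-index image). A group $G$ is linearly parametrizable if $G\cong\pi_1(\mathcal G)$ for some linearly parametrizable graph of groups $\mathcal G$. A group is (2-ended)-2-decomposable if it is the fundamental group of a graph of groups all of whose vertex and edge groups are 2-ended (infinite virtually cyclic). A group $G$ is balanced if for every infinite order $g\in G$, $hg^ih^{-1}=g^j$ with $h\in G$ implies $|i|=|j|$. *)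

(* Defs.v *)
From HB Require Import structures.
From mathcomp Require Import all_boot all_order all_algebra.
From mathcomp Require Import boolp classical_sets.

Set Implicit Arguments.
Unset Strict Implicit.
Unset Printing Implicit Defensive.

Import GRing.Theory.

Local Open Scope group_scope.

(** A [groupType] need not be finite; that it carries a choice structure is,
    classically, no restriction on the group. *)

Definition isomorphic (G H : groupType) : Prop :=
  exists f : {multiplicative G -> H}, bijective f.

Definition zexpg (G : groupType) (g : G) (i : int) : G :=
  match i with
  | Posz n => g ^+ n
  | Negz n => g ^- n.+1
  end.

Definition infinite_order (G : groupType) (g : G) : Prop :=
  forall n : nat, (0 < n)%N -> g ^+ n <> 1.

Definition balanced (G : groupType) : Prop :=
  forall g : G, infinite_order g ->
  forall (h : G) (i j : int),
    h * zexpg g i * h^-1 = zexpg g j -> `|i|%N = `|j|%N.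

Definition infinite_group (G : groupType) : Prop :=
  ~ exists s : seq G, forall x, x \in s.

(** Finitely many right cosets of the subgroup [H] cover [G]. *)
Definition finite_index (G : groupType) (H : set G) : Prop :=
  exists r : seq G, forall x, exists2 y, y \in r & H (x * y^-1).

Definition cyclic_subgroup (G : groupType) (g : G) : set G :=
  [set x | exists i : int, x = zexpg g i].

(** Infinite virtually cyclic. *)
Definition two_ended (G : groupType) : Prop :=
  infinite_group G /\ exists g : G, finite_index (cyclic_subgroup g).

Definition is_word_of_length (G : groupType) (S : seq G) (n : nat) (g : G) :
    Prop :=
  exists w : seq G,
    [/\ size w = n,
        forall x, x \in w -> x \in S \/ x^-1 \in S
      & g = \prod_(x <- w) x].

Definition generates (G : groupType) (S : seq G) : Prop :=
  forall g : G, exists n, is_word_of_length S n g.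

Lemma word_norm_subproof (G : groupType) (S : seq G) (genS : generates S)
  (g : G) : exists n, `[< is_word_of_length S n g >].
Proof. by have [n Hn] := genS g; exists n; apply/asboolP. Qed.

Definition word_norm (G : groupType) (S : seq G) (genS : generates S) (g : G) :
    nat :=
  ex_minn (word_norm_subproof genS g).

Definition word_dist (G : groupType) (S : seq G) (genS : generates S)
    (x y : G) : nat :=
  word_norm genS (x^-1 * y).

(** The constants may be taken in [nat] since they can always be increased;
    the second inequality is [dX x y / K - C <= dY (f x) (f y)]. *)
Definition quasi_isometry (X Y : Type) (dX : X -> X -> nat)
    (dY : Y -> Y -> nat) (f : X -> Y) : Prop :=
  exists K C : nat,
    [/\ (0 < K)%N,
        forall x y, (dY (f x) (f y) <= K * dX x y + C)%N,
        forall x y, (dX x y <= K * (dY (f x) (f y) + C))%N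
      & forall z, exists x, (dY (f x) z <= C)%N].

(** Word metrics for different finite generating sets are bi-Lipschitz
    equivalent, so the choice of [S] and [T] is immaterial. *)
Definition group_quasi_isometry (G H : groupType) (f : G -> H) : Prop :=
  exists (S : seq G) (T : seq H) (genS : generates S) (genT : generates T),
    quasi_isometry (word_dist genS) (word_dist genT) f.

(** The infinite dihedral group: [(m, s)] is the isometry
    [x |-> m + (-1) ^ s * x] of the integers. *)

Definition Dinf : Type := (int * bool)%type.
HB.instance Definition _ := Choice.on Dinf.

Definition Dinf_mul (x y : Dinf) : Dinf :=
  ((x.1 + (-1) ^+ x.2 * y.1)%R, x.2 (+) y.2).
Definition Dinf_one : Dinf := (0%R, false).
Definition Dinf_inv (x : Dinf) : Dinf := ((- ((-1) ^+ x.2 * x.1))%R, x.2).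

Lemma Dinf_mulA : associative Dinf_mul.
Proof.
move=> [x a] [y b] [z c]; rewrite /Dinf_mul /=; congr pair; last exact: addbA.
by rewrite mulrDr mulrA signr_addb addrA.
Qed.
Lemma Dinf_mul1 : left_id Dinf_one Dinf_mul.
Proof. by case=> x a; rewrite /Dinf_mul /= add0r mul1r. Qed.
Lemma Dinf_mulr1 : right_id Dinf_one Dinf_mul.
Proof. by case=> x a; rewrite /Dinf_mul /= mulr0 addr0 addbF. Qed.
Lemma Dinf_mulV : left_inverse Dinf_one Dinf_inv Dinf_mul.
Proof. by case=> x a; rewrite /Dinf_mul /= addNr addbb. Qed.
Lemma Dinf_mulrV : right_inverse Dinf_one Dinf_inv Dinf_mul.
Proof. by case=> x a; rewrite /Dinf_mul /= mulrN signrMK subrr addbb. Qed.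

HB.instance Definition _ := isGroup.Build Dinf
  Dinf_mulA Dinf_mul1 Dinf_mulr1 Dinf_mulV Dinf_mulrV.

(** Finite graphs, in the style of Serre: each geometric edge [e] carries the
    two darts [(e, true)] and [(e, false)], where [(e, b)] runs from [gend e b]
    to [gend e (~~ b)].  Loops and multiple edges are allowed. *)

Section Walks.
Variables (V E : finType) (gend : E -> bool -> V).

Definition dart : Type := (E * bool)%type.
Definition dsrc (d : dart) : V := gend d.1 d.2.
Definition dtgt (d : dart) : V := gend d.1 (~~ d.2).
Definition drev (d : dart) : dart := (d.1, ~~ d.2).

Fixpoint is_walk (u : V) (p : seq dart) (v : V) : Prop :=
  match p with
  | [::] => u = v
  | d :: q => dsrc d = u /\ is_walk (dtgt d) q v
  end.

Definition reduced (p : seq dart) : bool :=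
  sorted (fun d d' => d' != drev d) p.

Definition walk_in (T : {set E}) (p : seq dart) : bool :=
  all (fun d => d.1 \in T) p.

(** The subgraph with all the vertices and with edge set [T] is connected. *)
Definition connected_by (T : {set E}) : Prop :=
  forall u v, exists2 p, walk_in T p & is_walk u p v.

Definition acyclic_set (T : {set E}) : Prop :=
  forall u p, walk_in T p -> reduced p -> is_walk u p u -> p = [::].

Definition is_spanning_tree (T : {set E}) : Prop :=
  connected_by T /\ acyclic_set T.

End Walks.

HB.instance Definition _ (E : finType) := Finite.on (dart E).

Record graph_of_groups := GraphOfGroups {
  gvert : finType;
  gedge : finType;
  gend : gedge -> bool -> gvert;
  gvert_nonempty : (0 < #|gvert|)%N;
  gconnected : connected_by gend [set: gedge];
  vgrp : gvert -> groupType;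
  egrp : gedge -> groupType;
  emap : forall (e : gedge) (b : bool),
    {multiplicative egrp e -> vgrp (gend e b)};
  emap_inj : forall (e : gedge) (b : bool), injective (emap e b)
}.

Arguments gend : clear implicits.
Arguments emap : clear implicits.

Record spanning_tree (GG : graph_of_groups) := SpanningTree {
  tree_edges :> {set gedge GG};
  tree_edgesP : is_spanning_tree (gend GG) tree_edges
}.

(** The fundamental group of [GG] relative to the maximal tree [T], presented
    on the disjoint union of the vertex groups and one stable letter per dart.
    It is the set of words in the generators modulo the congruence spanned by
    the defining relations; up to isomorphism it does not depend on [T]. *)

Section FundamentalGroup.
Variables (GG : graph_of_groups) (T : spanning_tree GG).

Definition letter : Type :=
  ({v : gvert GG & vgrp v} + dart (gedge GG))%type.
HB.instance Definition _ := Choice.on letter.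

Definition vlet (v : gvert GG) (g : vgrp v) : letter :=
  inl (Tagged (fun v => vgrp v : Type) g).
Definition dlet (d : dart (gedge GG)) : letter := inr d.

Inductive pi1_relator : seq letter -> seq letter -> Prop :=
| Rel_one v : pi1_relator [:: vlet (1 : vgrp v)] [::]
| Rel_mul v (g h : vgrp v) :
    pi1_relator [:: vlet g; vlet h] [:: vlet (g * h)]
| Rel_rev d : pi1_relator [:: dlet d; dlet (drev d)] [::]
| Rel_tree d : d.1 \in (T : {set _}) -> pi1_relator [:: dlet d] [::]
| Rel_edge e b (a : egrp e) :
    pi1_relator
      [:: dlet (e, b); vlet (emap GG e (~~ b) a); dlet (drev (e, b))]
      [:: vlet (emap GG e b a)].

Inductive pi1_cong : seq letter -> seq letter -> Prop :=
| Cong_relator u v : pi1_relator u v -> pi1_cong u v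
| Cong_refl u : pi1_cong u u
| Cong_sym u v : pi1_cong u v -> pi1_cong v u
| Cong_trans v u w : pi1_cong u v -> pi1_cong v w -> pi1_cong u w
| Cong_cat u u' v v' :
    pi1_cong u u' -> pi1_cong v v' -> pi1_cong (u ++ v) (u' ++ v').

Definition pi1_rel : rel (seq letter) := fun u v => `[< pi1_cong u v >].

Lemma pi1_rel_refl : reflexive pi1_rel.
Proof. by move=> u; apply/asboolP; apply: Cong_refl. Qed.
Lemma pi1_rel_sym : symmetric pi1_rel.
Proof. by move=> u v; apply/asboolP/asboolP; apply: Cong_sym. Qed.
Lemma pi1_rel_trans : transitive pi1_rel.
Proof.
by move=> v u w /asboolP uv /asboolP vw; apply/asboolP; apply: Cong_trans uv vw.
Qed.

Canonical pi1_equiv_rel :=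
  EquivRel pi1_rel pi1_rel_refl pi1_rel_sym pi1_rel_trans.

Definition pi1 : Type := {eq_quot pi1_rel}%qT.
HB.instance Definition _ := Choice.on pi1.
HB.instance Definition _ := EqQuotient.on pi1.

Definition pi1_class (u : seq letter) : pi1 := (\pi_pi1 u)%qT.

Lemma pi1_classP u v : pi1_class u = pi1_class v <-> pi1_cong u v.
Proof.
split=> [/(@eqquotP _ _ pi1)/asboolP //|uv].
by apply/(@eqquotP _ _ pi1)/asboolP.
Qed.

Lemma pi1_reprP u : pi1_cong (repr (pi1_class u)) u.
Proof. by apply/pi1_classP; rewrite /pi1_class reprK. Qed.

Definition letter_inv (x : letter) : letter :=
  match x with
  | inl g => vlet (tagged g)^-1
  | inr d => dlet (drev d)
  end.

Definition pi1_one : pi1 := pi1_class [::].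
Definition pi1_mul (x y : pi1) : pi1 := pi1_class (repr x ++ repr y).
Definition pi1_inv (x : pi1) : pi1 :=
  pi1_class (rev (map letter_inv (repr x))).

Lemma pi1_mulE u v :
  pi1_mul (pi1_class u) (pi1_class v) = pi1_class (u ++ v).
Proof. by apply/pi1_classP; apply: Cong_cat; apply: pi1_reprP. Qed.

Lemma pi1W (P : pi1 -> Prop) : (forall u, P (pi1_class u)) -> forall x, P x.
Proof. by move=> Pu x; rewrite -[x]reprK; apply: Pu. Qed.

Lemma pi1_mulA : associative pi1_mul.
Proof.
by elim/pi1W=> u; elim/pi1W=> v; elim/pi1W=> w; rewrite !pi1_mulE catA.
Qed.
Lemma pi1_mul1 : left_id pi1_one pi1_mul.
Proof. by elim/pi1W=> u; rewrite pi1_mulE. Qed.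
Lemma pi1_mulr1 : right_id pi1_one pi1_mul.
Proof. by elim/pi1W=> u; rewrite pi1_mulE cats0. Qed.

Lemma letter_mulV x : pi1_cong [:: letter_inv x; x] [::].
Proof.
case: x => [[v g]|[e b]] /=.
  apply: Cong_trans (Cong_relator (Rel_mul _ _)) _.
  by rewrite mulVg; apply: Cong_relator; apply: Rel_one.
have := Cong_relator (Rel_rev (drev (e, b))).
by rewrite {2}/drev /= negbK.
Qed.

Lemma letter_mulrV x : pi1_cong [:: x; letter_inv x] [::].
Proof.
case: x => [[v g]|d] /=; last exact: Cong_relator (Rel_rev d).
apply: Cong_trans (Cong_relator (Rel_mul _ _)) _.
by rewrite mulgV; apply: Cong_relator; apply: Rel_one.
Qed.

Lemma pi1_cancel u y z v : pi1_cong [:: y; z] [::] ->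
  pi1_cong (u ++ [:: y, z & v]) (u ++ v).
Proof.
move=> yz; apply: Cong_cat (Cong_refl _) _.
by rewrite -[y :: _]/([:: y; z] ++ v); apply: Cong_cat yz (Cong_refl _).
Qed.

Lemma pi1_mulV : left_inverse pi1_one pi1_inv pi1_mul.
Proof.
move=> x; rewrite -{2}[x]reprK pi1_mulE; apply/pi1_classP.
elim: (repr x) => [|y u IHu] /=; first exact: Cong_refl.
rewrite rev_cons cat_rcons.
exact: Cong_trans (pi1_cancel _ _ (letter_mulV y)) IHu.
Qed.

Lemma pi1_mulrV : right_inverse pi1_one pi1_inv pi1_mul.
Proof.
move=> x; rewrite -{1}[x]reprK pi1_mulE; apply/pi1_classP.
elim/last_ind: (repr x) => [|u y IHu] /=; first exact: Cong_refl.
rewrite map_rcons rev_rcons cat_rcons.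
exact: Cong_trans (pi1_cancel _ _ (letter_mulrV y)) IHu.
Qed.

HB.instance Definition _ := isGroup.Build pi1
  pi1_mulA pi1_mul1 pi1_mulr1 pi1_mulV pi1_mulrV.

Definition pi1_vert (v : gvert GG) (g : vgrp v) : pi1 := pi1_class [:: vlet g].
(** The maps for [b = true] and [b = false] are conjugate by the stable letter
    of [e]. *)
Definition pi1_edge (e : gedge GG) (b : bool) (a : egrp e) : pi1 :=
  pi1_vert (emap GG e b a).

End FundamentalGroup.

Definition linear_parametrization (GG : graph_of_groups)
    (T : spanning_tree GG) (Phi : {multiplicative pi1 T -> Dinf}) : Prop :=
  (forall v : gvert GG,
     group_quasi_isometry (fun g : vgrp v => Phi (pi1_vert T g)))
  /\ (forall (e : gedge GG) (b : bool),
     group_quasi_isometry (fun a : egrp e => Phi (pi1_edge T b a))).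

(** One maximal tree is used both for [Phi] and for the isomorphism; a
    parametrization for one tree yields one for any other tree. *)
Definition linearly_parametrizable (G : groupType) : Prop :=
  exists (GG : graph_of_groups) (T : spanning_tree GG),
    (exists Phi : {multiplicative pi1 T -> Dinf}, linear_parametrization Phi)
    /\ isomorphic G (pi1 T).

Definition two_ended_2_decomposable (G : groupType) : Prop :=
  exists (GG : graph_of_groups) (T : spanning_tree GG),
    [/\ forall v : gvert GG, two_ended (vgrp v),
        forall e : gedge GG, two_ended (egrp e)
      & isomorphic G (pi1 T)].

(* Main.v *)
(** Forward direction: a quasi-isometric homomorphism to [Dinf] makes vertex and
    edge groups two-ended and preserves infinite order on them, so elements
    conjugate into vertex groups inherit balancedness from [Dinf].  Any other
    element is conjugate to a cyclically reduced closed path [w] with [n > 0]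
    darts.  All vertex groups act freely on one countable set carrying a level
    function; the stable letters can be chosen as equivariant bijections that
    drop the level by one along the infinite path [w w w ...] and preserve it on
    all other orbits.  Then [w ^+ m] displaces levels by exactly [n * m], while
    every element has bounded displacement, so [h w^i h^-1 = w^j] forces
    [|i| = |j|].  This replaces normal forms and the Bass-Serre tree.

    Backward direction: the same action shows that vertex groups embed.  Their
    infinite order elements are all commensurable, so balancedness and finite
    generation give a normal infinite cyclic subgroup [<zeta>] lying in every
    vertex and edge group; conjugation on it is a sign character [eps].
    Averaging over cosets of [<zeta>] yields on each vertex group a rational
    cocycle twisted by [eps] and equal to [1] at [zeta].  On an edge group two
    such cocycles differ by a coboundary, which is absorbed in the image of the
    stable letter.  Clearing denominators turns the resulting homomorphism to
    the isometries of the rational line into one to [Dinf]. *)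
From HB Require Import structures.
From mathcomp Require Import all_boot all_order all_algebra.
From mathcomp Require Import boolp classical_sets functions cardinality.
From mathcomp Require Import zify ring lra.
Require Import Defs.

Set Implicit Arguments.
Unset Strict Implicit.
Unset Printing Implicit Defensive.

Import Order.TTheory GRing.Theory Num.Theory.

Local Open Scope group_scope.

(** * Groups and integer powers *)

Lemma choice_dep (I : Type) (A : I -> Type) (R : forall i, A i -> Prop) :
  (forall i, exists a, R i a) -> exists f : forall i, A i, forall i, R i (f i).
Proof. by move=> h; exists (fun i => projT1 (cid (h i))) => i; case: cid. Qed.

Section IntegerPowers.
Variable G : groupType.
Implicit Types (g h x y : G) (i j : int).

Lemma zexpg1 g : zexpg g 1 = g.
Proof. by []. Qed.

Lemma zexpgS g i : zexpg g (i + 1)%R = zexpg g i * g.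
Proof.
case: i => [n|[|n]].
- by rewrite addrC -intS /= expgSr.
- by rewrite /= expg1 mulVg.
rewrite (_ : (Negz n.+1 + 1)%R = Negz n); last by rewrite !NegzE; lia.
by rewrite /= (expgS _ n.+1) invgM mulgVK.
Qed.

Lemma zexpgD g i j : zexpg g (i + j)%R = zexpg g i * zexpg g j.
Proof.
elim: j => [|n IHn|n IHn].
- by rewrite addr0 /= mulg1.
- by rewrite intS (addrC 1%R) addrA !zexpgS IHn mulgA.
apply: (mulIg g); rewrite -zexpgS -mulgA -zexpgS.
rewrite (_ : (i - n.+1%:Z + 1)%R = (i - n%:Z)%R); last lia.
by rewrite (_ : (- n.+1%:Z + 1)%R = (- n%:Z)%R) ?IHn //; lia.
Qed.

Lemma zexpgN g i : zexpg g (- i)%R = (zexpg g i)^-1.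
Proof. by apply/esym/mulg1_eq; rewrite -zexpgD subrr. Qed.

Lemma zexpg_nat g (n : nat) : zexpg g n = g ^+ n.
Proof. by []. Qed.

Lemma zexpgM g i j : zexpg g (i * j)%R = zexpg (zexpg g i) j.
Proof.
elim: j => [|n IHn|n IHn].
- by rewrite mulr0.
- rewrite intS (addrC 1%R).
  by rewrite mulrDr mulr1 zexpgD zexpgS IHn.
rewrite (_ : (- n.+1%:Z)%R = (- n%:Z - 1)%R); last lia.
by rewrite mulrBr mulr1 !zexpgD IHn [zexpg g (- i)]zexpgN.
Qed.

Lemma zexpg_sign g i : exists b : bool,
  zexpg g i = zexpg (g ^+ `|i|%N) ((-1) ^+ b)%R.
Proof.
exists (i < 0)%R; rewrite -[g ^+ _]/(zexpg g `|i|%N) -zexpgM; congr zexpg.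
by rewrite abszE mulrC -intEsign.
Qed.

Lemma conj_mul h x y : h * (x * y) * h^-1 = (h * x * h^-1) * (h * y * h^-1).
Proof. by rewrite !mulgA mulgVK. Qed.

Lemma conj_inv h x : h * x^-1 * h^-1 = (h * x * h^-1)^-1.
Proof. by rewrite !invgM invgK mulgA. Qed.

Lemma conj_expg h x n : h * x ^+ n * h^-1 = (h * x * h^-1) ^+ n.
Proof.
elim: n => [|n IHn]; first by rewrite !expg0 mulg1 mulgV.
by rewrite !expgS conj_mul IHn.
Qed.

Lemma conj_zexpg h x i : h * zexpg x i * h^-1 = zexpg (h * x * h^-1) i.
Proof. by case: i => n; rewrite /= ?conj_inv conj_expg. Qed.

Lemma infinite_order_zexpg g : infinite_order g ->
  forall i, zexpg g i = 1 -> i = 0%R.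
Proof.
move=> og [[|n]|n] //=; first by move/(og n.+1 isT).
by move/(canRL invgK); rewrite invg1 => /(og n.+1 isT).
Qed.

Lemma zexpg_infinite_order g :
  (forall i, zexpg g i = 1 -> i = 0%R) -> infinite_order g.
Proof. by move=> og [//|n] _ /(og (Posz n.+1)). Qed.

Lemma zexpg_inj g : infinite_order g -> injective (zexpg g).
Proof.
move=> og i j eij; apply/eqP; rewrite -subr_eq0; apply/eqP.
by apply: (infinite_order_zexpg og); rewrite zexpgD zexpgN eij mulgV.
Qed.

Lemma infinite_order_pow g i :
  infinite_order g -> i <> 0%R -> infinite_order (zexpg g i).
Proof.
move=> og i0; apply: zexpg_infinite_order => j; rewrite -zexpgM.
by move/(infinite_order_zexpg og)/eqP; rewrite mulf_eq0 => /orP[] /eqP.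
Qed.

Lemma infinite_order_conj g h :
  infinite_order g -> infinite_order (h * g * h^-1).
Proof.
move=> og n n0; rewrite -conj_expg => /(congr1 (fun x => h^-1 * x * h)).
by rewrite -mulgA mulgVK mulKg mulg1 mulVg => /(og _ n0).
Qed.

End IntegerPowers.

Section Morphisms.
Variables (G H : groupType) (f : G -> H).
Hypothesis fM : {morph f : x y / x * y}.

Lemma morph_one : f 1 = 1.
Proof. by apply: (mulgI (f 1)); rewrite -fM !mulg1. Qed.

Lemma morph_inv g : f g^-1 = (f g)^-1.
Proof. by apply/esym/mulg1_eq; rewrite -fM mulgV morph_one. Qed.

Lemma morph_expg g n : f (g ^+ n) = f g ^+ n.
Proof.
elim: n => [|n IHn]; first exact: morph_one.
by rewrite !expgS fM IHn.
Qed.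

Lemma morph_zexpg g i : f (zexpg g i) = zexpg (f g) i.
Proof. by case: i => n; rewrite /= ?morph_inv morph_expg. Qed.

Lemma infinite_order_of_image g : infinite_order (f g) -> infinite_order g.
Proof.
by move=> o n n0 gn; apply: (o n n0); rewrite -morph_expg gn morph_one.
Qed.

Lemma infinite_order_image g :
  injective f -> infinite_order g -> infinite_order (f g).
Proof.
by move=> fI o n n0; rewrite -morph_expg -morph_one => /fI /(o n n0).
Qed.

End Morphisms.

Lemma balanced_iso (G H : groupType) : isomorphic G H -> balanced H -> balanced G.
Proof.
case=> f /bij_inj fI bal g og h i j /(congr1 f).
have fM : {morph f : x y / x * y} by exact: gmulfM.
rewrite !fM (morph_inv fM) !(morph_zexpg fM); apply: bal.
exact: infinite_order_image fI og.
Qed.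

Lemma isomorphic_sym (G H : groupType) : isomorphic G H -> isomorphic H G.
Proof.
case=> f [k fk kf].
have kM : {morph k : x y / x * y} by exact: can2_gmulfM fk kf.
pose K := HB.pack_for {multiplicative H -> G} k (isMultiplicative.Build _ _ k kM).
by exists K; exists f.
Qed.

(** A length function growing linearly along the powers of [s]; it is given
    by its sublevel sets, so that it need not be attained. *)
Lemma balanced_of_length (Q : groupType) (len : Q -> nat -> Prop)
    (lenM : forall x y c d, len x c -> len y d -> len (x * y) (c + d)%N)
    (lenV : forall x c, len x c -> len x^-1 c)
    (s t : Q) (i j : int) (n c : nat) : (0 < n)%N ->
  (forall m, len (s ^+ m) (n * m)%N) ->
  (forall m k, len (s ^+ m) k -> (n * m <= k)%N) ->
  len t c -> t * zexpg s i * t^-1 = zexpg s j -> `|i|%N = `|j|%N.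
Proof.
move=> n0 up low.
have lenZ k m : len (zexpg s k ^+ m) (n * (`|k| * m))%N.
  have [b ->] := zexpg_sign s k.
  case: b; rewrite (expr0, expr1) ?zexpgN zexpg1 ?expVgn -expgnA; last exact: up.
  exact/lenV/up.
have lowZ k m d : len (zexpg s k ^+ m) d -> (n * (`|k| * m) <= d)%N.
  have [b ->] := zexpg_sign s k.
  case: b; rewrite (expr0, expr1) ?zexpgN zexpg1 ?expVgn -expgnA; last exact: low.
  by move/lenV; rewrite invgK; apply: low.
(* One inequality suffices: conjugating back by [t^-1] exchanges the two exponents. *)
suff le u i' j' : len u c -> u * zexpg s i' * u^-1 = zexpg s j' ->
    (`|j'| <= `|i'|)%N.
  move=> lt e; apply/eqP; rewrite eqn_leq (le _ _ _ lt e) andbT.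
  apply: (le t^-1); first exact: lenV.
  by rewrite -e !mulgA invgK mulgVK mulVg mul1g.
move=> lu e; rewrite leqNgt; apply/negP => lt.
(* Conjugation by [u] changes lengths by at most [c + c], whereas a gap between the exponents is
   multiplied by [m]; this [m] exceeds the slack. *)
pose m := (c + c).+1.
have /lowZ : len (zexpg s j' ^+ m) (c + n * (`|i'| * m) + c)%N.
  rewrite -e -conj_expg; apply/lenM; last exact/lenV.
  exact/lenM.
have : (`|i'|.+1 * m <= `|j'| * m)%N by rewrite leq_mul2r lt orbT.
rewrite -(leq_pmul2l n0) => h1 /(leq_trans h1).
rewrite mulSn mulnDr addnAC leq_add2r => h2.
suff : (n * m <= c + c)%N by rewrite /m; nia.
lia.
Qed.

(** * Two-ended groups and quasi-isometries to the infinite dihedral group *)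

Lemma seq_bound (A : eqType) (F : A -> nat) (s : seq A) :
  exists B, forall x, x \in s -> (F x <= B)%N.
Proof.
exists (\max_(x <- s) F x) => x xs.
exact: leq_bigmax_seq.
Qed.

Lemma pow_not_in_seq (G : groupType) (g : G) (s : seq G) :
  infinite_order g -> ~ (forall m, g ^+ m \in s).
Proof.
move=> og gs; pose t := [seq g ^+ m | m <- iota 0 (size s).+1].
have /uniq_leq_size : uniq t.
  rewrite map_inj_uniq ?iota_uniq // => i j /=.
  rewrite -[LHS]/(zexpg g i) -[RHS]/(zexpg g j).
  by move=> /(zexpg_inj og) [].
move=> /(_ s); rewrite size_map size_iota ltnn => h; apply: notF; apply: h.
by move=> x /mapP[m _ ->].
Qed.

(** * Word norms *)

Section WordNorm.
Variables (G : groupType) (S : seq G).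

Lemma is_word_one : is_word_of_length S 0 1.
Proof. by exists [::]; split => //; rewrite big_nil. Qed.

Lemma is_word_gen x : x \in S \/ x^-1 \in S -> is_word_of_length S 1 x.
Proof.
move=> xS; exists [:: x]; split=> //; last by rewrite big_seq1.
by move=> y; rewrite inE => /eqP ->.
Qed.

Lemma is_word_mul m n x y : is_word_of_length S m x -> is_word_of_length S n y ->
  is_word_of_length S (m + n) (x * y).
Proof.
move=> [u [su uS ->]] [v [sv vS ->]]; exists (u ++ v); split.
- by rewrite size_cat su sv.
- by move=> z; rewrite mem_cat => /orP[/uS|/vS].
by rewrite big_cat.
Qed.

Lemma is_word_expg n x : x \in S \/ x^-1 \in S -> is_word_of_length S n (x ^+ n).
Proof.
move=> xS; elim: n => [|n IHn]; first exact: is_word_one.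
by rewrite expgS -add1n; apply: is_word_mul (is_word_gen xS) IHn.
Qed.

Lemma is_word_zexpg i x : x \in S -> is_word_of_length S `|i|%N (zexpg x i).
Proof.
move=> xS; case: i => n /=; first by apply: is_word_expg; left.
by rewrite -expVgn; apply: is_word_expg; rewrite invgK; right.
Qed.

Variable genS : generates S.

Lemma word_normP g : is_word_of_length S (word_norm genS g) g.
Proof. by rewrite /word_norm; case: ex_minnP => n /asboolP. Qed.

Lemma word_norm_le n g : is_word_of_length S n g -> (word_norm genS g <= n)%N.
Proof. by move=> w; rewrite /word_norm; case: ex_minnP => m _; apply; apply/asboolP. Qed.

Lemma word_normM x y :
  (word_norm genS (x * y)%g <= word_norm genS x + word_norm genS y)%N.
Proof. by apply: word_norm_le; apply: is_word_mul; apply: word_normP. Qed.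

Lemma word_norm1 : word_norm genS 1 = 0.
Proof. by apply/eqP; rewrite -leqn0; apply: word_norm_le is_word_one. Qed.

Lemma word_ball_finite n :
  exists s : seq G, forall g, (word_norm genS g <= n)%N -> g \in s.
Proof.
suff [s sP] : exists s : seq G, forall g k, (k <= n)%N ->
    is_word_of_length S k g -> g \in s.
  by exists s => g gn; apply: sP gn (word_normP g).
elim: n => [|n [s IHs]].
  exists [:: 1] => g k; rewrite leqn0 => /eqP -> [w [/size0nil -> _ ->]].
  by rewrite big_nil inE.
exists (s ++ [seq x * y | x <- S ++ [seq x^-1 | x <- S], y <- s]) => g k.
rewrite leq_eqVlt mem_cat => /orP[/eqP ->|kn /(IHs _ _ kn) -> //].
case=> -[[]//|x w [[sw] wS ->]]; apply/orP; right.
rewrite big_cons; apply: allpairs_f; last first.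
  apply: (IHs _ n) => //; exists w; split=> // y yw.
  by apply: wS; rewrite inE yw orbT.
rewrite mem_cat; have [-> //|] := wS x (mem_head _ _).
by move=> xS; apply/orP; right; apply/mapP; exists x^-1; rewrite // invgK.
Qed.

End WordNorm.

(** The constant is the largest norm of the image of a generator or of its inverse. *)
Lemma word_norm_morph (G H : groupType) (f : G -> H) (S : seq G) (T : seq H)
    (genS : generates S) (genT : generates T) : {morph f : x y / x * y} ->
  exists L, forall g, (word_norm genT (f g) <= L * word_norm genS g)%N.
Proof.
move=> fM; have [L LP] := seq_bound (fun x => word_norm genT (f x)) (S ++ [seq x^-1 | x <- S]).
exists L => g; have [w [<- wS ->]] := word_normP genS g.
elim: w wS => [|x w IHw] wS; first by rewrite big_nil (morph_one fM) word_norm1.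
rewrite big_cons fM /= mulnS; apply: leq_trans (word_normM _ _ _) _.
rewrite leq_add ?IHw // => [|y yw]; last by apply: wS; rewrite inE yw orbT.
apply: LP; rewrite mem_cat; have [-> //|xS] := wS x (mem_head _ _).
by apply/orP; right; apply/mapP; exists x^-1; rewrite // invgK.
Qed.

Section CyclicFiniteIndex.
Variables (G : groupType) (z : G) (r : seq G).
Hypothesis cover : forall x, exists i y, y \in r /\ x = zexpg z i * y.

(** Pigeonhole: two of the powers of [x] with exponent at most [size r] share a representative in
    [r], and their quotient is a power of [z]. *)
Lemma power_in_cyclic x : exists2 k, (0 < k)%N & exists i, x ^+ k = zexpg z i.
Proof.
have /choice [h hP] : forall m : nat, exists y,
    y \in r /\ exists i, x ^+ m = zexpg z i * y.
  by move=> m; have [i [y [yr e]]] := cover (x ^+ m); exists y; split=> //; exists i.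
pose t := [seq h m | m <- iota 0 (size r).+1].
have /(uniqPn (h 0)) [i [j [ij]]] : ~~ uniq t.
  apply/negP=> /uniq_leq_size => /(_ r); rewrite size_map size_iota ltnn => h'.
  by apply: notF; apply: h' => y /mapP[m _ ->]; case: (hP m).
rewrite size_map size_iota => jr.
rewrite !(nth_map 0) ?size_iota // ?(ltn_trans ij) // !nth_iota // ?(ltn_trans ij) //.
rewrite !add0n => hij.
have [_ [k ek]] := hP i; have [_ [l el]] := hP j.
exists (j - i); first by rewrite subn_gt0.
exists (l - k)%R; rewrite expgnFr ?(ltnW ij) // el ek hij zexpgD zexpgN.
by rewrite invgM mulgA mulgK.
Qed.

End CyclicFiniteIndex.

(** If [z] had finite order [n], the products [z ^+ m * y] with [m < n] and [y] in [r] would exhaust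
    the group. *)
Lemma two_endedP (G : groupType) : two_ended G ->
  exists z (r : seq G), infinite_order z /\
    forall x, exists i y, y \in r /\ x = zexpg z i * y.
Proof.
case=> infG [z [r rP]]; exists z, r.
have cover x : exists i y, y \in r /\ x = zexpg z i * y.
  by have [y yr [i e]] := rP x; exists i, y; split=> //; rewrite -e mulgVK.
split=> // n n0 zn; apply: infG.
exists [seq z ^+ m * y | m <- iota 0 n, y <- r] => x.
have [i [y [yr ->]]] := cover x.
have -> : zexpg z i = z ^+ `|(i %% n)%Z|%N.
  rewrite -[RHS]/(zexpg z `|(i %% n)%Z|%N) gez0_abs; last by rewrite modz_ge0 ?eqz_nat -?lt0n.
  rewrite {1}(divz_eq i n) zexpgD mulrC zexpgM zexpg_nat zn.
  suff -> : zexpg 1 (i %/ n)%Z = 1 :> G by rewrite mul1g.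
  by case: (i %/ n)%Z => m; rewrite /= expg1n ?invg1.
apply: allpairs_f => //; rewrite mem_iota add0n /=.
have := ltz_mod i (_ : (n%:Z != 0)%R); rewrite eqz_nat -lt0n => /(_ n0).
by rewrite -{1}[(i %% n)%Z]gez0_abs ?modz_ge0 ?eqz_nat -?lt0n //.
Qed.

Lemma two_ended_of_cover (G : groupType) z (r : seq G) : infinite_order z ->
  (forall x, exists i y, y \in r /\ x = zexpg z i * y) -> two_ended G.
Proof.
move=> oz cover; split; first by case=> s sP; apply: (pow_not_in_seq (s := s) oz).
exists z, r => x; have [i [y [yr ->]]] := cover x; exists y => //.
by exists i; rewrite mulgK.
Qed.

(** * Translations and word norm in the infinite dihedral group *)

Section Dihedral.

Lemma Dinf_mulE (a b : int) (s t : bool) :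
  ((a, s) : Dinf) * ((b, t) : Dinf) = (a + (-1) ^+ s * b, s (+) t)%R :> Dinf.
Proof. by []. Qed.

Lemma Dinf_invE (a : int) (s : bool) :
  ((a, s) : Dinf)^-1 = (- ((-1) ^+ s * a), s)%R :> Dinf.
Proof. by []. Qed.

Lemma Dinf_trans_morph (a b : int) :
  ((a, false) : Dinf) * ((b, false) : Dinf) = (a + b, false)%R :> Dinf.
Proof. by rewrite Dinf_mulE mul1r. Qed.

Lemma Dinf_expg (a : int) n : ((a, false) : Dinf) ^+ n = (a * n%:Z, false)%R :> Dinf.
Proof.
elim: n => [|n IHn]; first by rewrite mulr0.
by rewrite expgS IHn Dinf_trans_morph intS mulrDr mulr1.
Qed.

Lemma Dinf_zexpg (a i : int) : zexpg ((a, false) : Dinf) i = (a * i, false)%R.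
Proof.
case: i => n; first exact: Dinf_expg.
by rewrite /zexpg Dinf_expg Dinf_invE expr0 mul1r NegzE mulrN.
Qed.

Lemma Dinf_infinite_order (x : Dinf) : infinite_order x ->
  exists2 a : int, (a != 0)%R & x = (a, false).
Proof.
case: x => a [] o.
  by have := o 2 isT; rewrite expg2 Dinf_mulE mulN1r subrr addbb.
exists a => //; apply/eqP => a0; have := o 1%N isT.
by rewrite expg1 a0.
Qed.

Lemma Dinf_translation_order (a : int) :
  (a != 0)%R -> infinite_order ((a, false) : Dinf).
Proof.
move=> a0 n n0; rewrite Dinf_expg => -[] /eqP; rewrite mulf_eq0 (negPf a0) /=.
by rewrite eqz_nat -leqn0 leqNgt n0.
Qed.

Definition Dinf_gens : seq Dinf := [:: (1%R, false); (0%R, true)].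

(** A power of the unit translation, followed if necessary by the reflection at the origin, spells
    any element; so the norm exceeds the absolute translation part by at most one. *)
Lemma Dinf_word (x : Dinf) : exists2 n, (n <= `|x.1|.+1)%N & is_word_of_length Dinf_gens n x.
Proof.
case: x => a s; have wa : is_word_of_length Dinf_gens `|a|%N (a, false).
  have := @is_word_zexpg Dinf Dinf_gens a (1%R, false) (mem_head _ _).
  by rewrite Dinf_zexpg mul1r.
case: s; last by exists `|a|%N.
exists (`|a| + 1)%N; first by rewrite addn1.
have -> : (a, true) = ((a, false) : Dinf) * ((0%R, true) : Dinf) :> Dinf.
  by rewrite Dinf_mulE mulr0 addr0.
by apply: is_word_mul wa (is_word_gen _); left; rewrite !inE eqxx orbT.
Qed.

Lemma Dinf_generates : generates Dinf_gens.
Proof. by move=> x; have [n _ ?] := Dinf_word x; exists n. Qed.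

Lemma Dinf_norm_le x : (word_norm Dinf_generates x <= `|x.1|.+1)%N.
Proof. by have [n nx /(word_norm_le Dinf_generates) /leq_trans] := Dinf_word x; apply. Qed.

Lemma Dinf_norm_ge x : (`|x.1| <= word_norm Dinf_generates x)%N.
Proof.
have [w [<- wT ->]] := word_normP Dinf_generates x.
elim: w wT => [|y w IHw] wT; first by rewrite big_nil.
have wT' v : v \in w -> v \in Dinf_gens \/ v^-1 \in Dinf_gens.
  by move=> vw; apply: wT; rewrite inE vw orbT.
move: {IHw wT'}(IHw wT'); rewrite big_cons /=.
set p := \prod_(_ <- _) _ => IHw.
have y1 : (`|y.1| <= 1)%N.
  have := wT y (mem_head _ _); case: (y) => a s.
  rewrite Dinf_invE !inE /=; case: s; rewrite ?expr0 ?expr1 => -[] /orP[] /eqP[] //; lia.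
case: y {wT} y1 => a s /= a1.
by case: s; rewrite ?expr0 ?expr1 ?mul1r ?mulN1r; lia.
Qed.

End Dihedral.

(** * Quasi-isometric homomorphisms to the infinite dihedral group *)

Section QuasiIsometricMorphism.
Variables (G : groupType) (f : G -> Dinf).
Hypotheses (fM : {morph f : x y / x * y}) (fQI : group_quasi_isometry f).

(** The lower quasi-isometry bound, applied at the identity, confines the preimages to a ball, and
    balls are finite. *)
Lemma qi_preimage_finite (t : seq Dinf) :
  exists s : seq G, forall x, f x \in t -> x \in s.
Proof.
case: fQI => S [T [genS [genT [K [C [K0 _ lo _]]]]]].
have [B BP] := seq_bound (word_norm genT) t.
have [s sP] := word_ball_finite genS (K * (B + C)).
exists s => x xt; apply: sP.
have := lo 1 x; rewrite /word_dist invg1 mul1g => /leq_trans; apply.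
rewrite leq_mul2l leq_add2r (morph_one fM) invg1 mul1g BP //.
by rewrite orbT.
Qed.

(** The kernel is finite, so it cannot contain all powers of [x ^+ n]. *)
Lemma qi_infinite_order x : infinite_order x -> infinite_order (f x).
Proof.
move=> ox n n0 fxn; have [s sP] := qi_preimage_finite [:: 1].
have oxn : infinite_order (x ^+ n).
  have := @infinite_order_pow _ x n ox; apply => -[]; lia.
apply: (pow_not_in_seq (s := s) oxn) => m; apply: sP.
by rewrite !(morph_expg fM) fxn expg1n inE.
Qed.

Lemma qi_translation : exists g, infinite_order (f g).
Proof.
case: fQI => S [T [genS [genT [K [C [K0 _ _ surj]]]]]].
have [s sP] := word_ball_finite genT C.
have [B BP] := seq_bound (fun x : Dinf => `|x.1|%N) s.
have near (m : int) : exists x, (`|(f x).1 - m| <= B)%N.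
  have [x xm] := surj ((m, false) : Dinf); exists x.
  have /BP := sP _ xm; case: (f x) => a t; rewrite Dinf_invE Dinf_mulE /=.
  by case: t; rewrite ?expr0 ?expr1 ?mul1r ?mulN1r; lia.
(* These targets make the translation parts of the two images nonzero and distinct; if both images
   are reflections, their product translates by the difference. *)
have [x1] := near (Posz B.+1); have [x2] := near (Posz (4 * B.+1)).
move e1: (f x1) => [a1 s1]; move e2: (f x2) => [a2 s2] /= h2 h1.
case: s1 e1 => e1; last first.
  by exists x1; rewrite e1; apply: Dinf_translation_order; lia.
case: s2 e2 => e2; last first.
  by exists x2; rewrite e2; apply: Dinf_translation_order; lia.
exists (x1 * x2); rewrite fM e1 e2 Dinf_mulE /=; apply: Dinf_translation_order.
rewrite expr1 mulN1r; lia.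
Qed.

(** Dividing by the translation length of [f g] reduces the translation part of any image to a
    remainder; the elements with such images form a finite set of coset representatives. *)
Lemma qi_two_ended : two_ended G.
Proof.
have [g og] := qi_translation.
have [t t0 eg] := Dinf_infinite_order og.
have ogG := infinite_order_of_image fM og.
have [r rP] := qi_preimage_finite
  [seq (Posz a, s) : Dinf | a <- iota 0 `|t|%N, s <- [:: true; false]].
apply: (two_ended_of_cover (z := g) (r := r) ogG) => x.
case e: (f x) => [a s].
exists (a %/ t)%Z, (zexpg g (- (a %/ t)%Z)%R * x).
rewrite mulgA -zexpgD subrr mul1g; split=> //.
apply: rP; rewrite fM (morph_zexpg fM) eg Dinf_zexpg e Dinf_mulE /= expr0 mul1r.
have ae := divz_eq a t; have m0 := modz_ge0 a t0; have mt := ltz_mod a t0.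
have -> : (t * - (a %/ t)%Z + a = `|(a %% t)%Z|%N%:Z)%R by lia.
apply/flatten_mapP; exists `|(a %% t)%Z|%N; first by rewrite mem_iota; lia.
by case: (s); rewrite !inE eqxx ?orbT.
Qed.

End QuasiIsometricMorphism.

(** On [zexpg z i * y] with [y] in a finite set, the word norm and the translation part of the image
    are both comparable with the absolute value of [i], because [f z] is a nontrivial
    translation. *)
Lemma two_ended_qi (G : groupType) (f : G -> Dinf) (u : G) :
  {morph f : x y / x * y} -> two_ended G -> infinite_order (f u) ->
  group_quasi_isometry f.
Proof.
move=> fM /two_endedP[z [r [oz cover]]] ofu.
(* A power of [u] is a power of [z], so [f z] of finite order would force [f u] to have finite
   order. *)
have [m m0 ez] : exists2 m : int, (m != 0)%R & f z = (m, false).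
  apply: Dinf_infinite_order => n n0 fzn.
  have [k k0 [i e]] := power_in_cyclic cover u.
  apply: (ofu (k * n)%N); first by rewrite muln_gt0 k0.
  rewrite expgnA -!(morph_expg fM) e (morph_expg fM) (morph_zexpg fM).
  rewrite -zexpg_nat -zexpgM mulrC zexpgM zexpg_nat fzn.
  by case: (i) => j /=; rewrite expg1n ?invg1.
have S0 : exists2 B, forall x i, f (zexpg z i * x) = (m * i + (f x).1, (f x).2)%R
    & forall x, x \in r -> (`|(f x).1| <= B)%N.
  have [B BP] := seq_bound (fun x => `|(f x).1|%N) r; exists B => // x i.
  rewrite fM (morph_zexpg fM) ez Dinf_zexpg; case: (f x) => a s.
  by rewrite Dinf_mulE expr0 mul1r.
have [B fz BP] := S0.
pose S := z :: r.
have word x : exists i y, [/\ y \in r, x = zexpg z i * y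
    & is_word_of_length S (`|i| + 1)%N x].
  have [i [y [yr e]]] := cover x; exists i, y; split=> //; rewrite e.
  apply: is_word_mul (is_word_gen _); last by left; rewrite inE yr orbT.
  by apply: is_word_zexpg; rewrite mem_head.
have genS : generates S by move=> x; have [i [y [_ _ w]]] := word x; eexists; exact: w.
have [L LP] := word_norm_morph genS Dinf_generates fM.
exists S, Dinf_gens, genS, Dinf_generates, L.+1, (`|m| + B).+2; split=> //.
- move=> x y; rewrite /word_dist -(morph_inv fM) -fM.
  by apply: leq_trans (LP _) _; rewrite mulSn addnAC leq_addl.
- move=> x y; rewrite /word_dist -(morph_inv fM) -fM; set g := _ * _.
  have [i [w [wr e /(word_norm_le genS)]]] := word g.
  have := Dinf_norm_ge (f g); have := BP w wr; rewrite {1}e fz /=.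
  have : (`|i| <= `|(m * i)%R|)%N by rewrite abszM leq_pmull // absz_gt0.
  move: (word_norm genS g) (word_norm Dinf_generates (f g)) (f w).1 => p q c.
  move=> h1 h2 h3 h4; apply: leq_trans (leq_pmull _ (ltn0Sn L)).
  by move: (m * i)%R h1 h3 => mi h1 h3; lia.
(* Coarse surjectivity: this power of [z] misses the target by the remainder of [a] modulo [m] and
   possibly a reflection. *)
case=> a s; exists (zexpg z (a %/ m)%Z).
rewrite /word_dist (morph_zexpg fM) ez Dinf_zexpg Dinf_invE Dinf_mulE.
apply: leq_trans (Dinf_norm_le _) _ => /=; rewrite expr0 !mul1r.
have ae := divz_eq a m; have m1 := modz_ge0 a m0; have mt := ltz_mod a m0.
have -> : (- (m * (a %/ m)%Z) + a = (a %% m)%Z)%R by lia.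
lia.
Qed.

(** Both elements have a power in one cyclic subgroup of finite index; cross-multiplying the
    exponents equates powers of [x] and [y]. *)
Lemma two_ended_power (G : groupType) (x y : G) :
  two_ended G -> infinite_order x -> infinite_order y ->
  exists2 k, (0 < k)%N & exists2 i : int, (i != 0)%R & x ^+ k = zexpg y i.
Proof.
move=> /two_endedP[z [r [oz cover]]] ox oy.
have [k k0 [i e]] := power_in_cyclic cover x.
have [l l0 [j e']] := power_in_cyclic cover y.
have nz (g : G) n p : infinite_order g -> (0 < n)%N -> g ^+ n = zexpg z p -> (p != 0)%R.
  by move=> og n0 h; apply/eqP => p0; apply: (og n n0); rewrite h p0.
have i0 := nz _ _ _ ox k0 e; have j0 := nz _ _ _ oy l0 e'.
have e1 : zexpg x (k%:Z * j)%R = zexpg y (l%:Z * i)%R.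
  by rewrite !zexpgM !zexpg_nat e e' -!zexpgM mulrC.
exists (k * `|j|)%N; first by rewrite muln_gt0 k0 absz_gt0.
exists (l%:Z * i * sgz j)%R; first by rewrite !mulf_neq0 ?sgz_eq0 // eqz_nat -lt0n.
rewrite zexpgM -e1 -zexpgM -zexpg_nat; congr zexpg.
by rewrite PoszM abszEsg; nia.
Qed.

(** * Homomorphisms out of the fundamental group *)

Section WalkFacts.
Variables (V E : finType) (gend : E -> bool -> V).
Implicit Types (p q : seq (dart E)).

Lemma dtgt_rev d : dtgt gend (drev d) = dsrc gend d.
Proof. by rewrite /dtgt /drev /= negbK. Qed.

Lemma is_walk_cat u v w p q :
  is_walk gend u p v -> is_walk gend v q w -> is_walk gend u (p ++ q) w.
Proof. by elim: p u => [u -> //|d p IHp u [<- /IHp h] /h]. Qed.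

Lemma is_walk_split u w p q : is_walk gend u (p ++ q) w ->
  exists2 v, is_walk gend u p v & is_walk gend v q w.
Proof.
elim: p u => [u|d p IHp u /= [<- /IHp[v pv qv]]]; first by exists u.
by exists v.
Qed.

Lemma unreduced_split p : ~~ reduced p ->
  exists p1 d p2, p = p1 ++ [:: d, drev d & p2].
Proof.
rewrite /reduced; case: p => [//|d p] /=; elim: p d => [//|d' p IHp] d /=.
rewrite negb_and negbK => /orP[/eqP ->|/IHp[p1 [c [p2 ->]]]].
  by exists [::], d, p.
by exists (d :: p1), c, p2.
Qed.

(** Backtracks cancel in the product, and a closed walk in the tree without backtracks is empty. *)
Lemma tree_walk_trivial (Q : groupType) (T : {set E}) (td : dart E -> Q) u p :
  acyclic_set gend T -> (forall d, td (drev d) = (td d)^-1) ->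
  walk_in T p -> is_walk gend u p u -> \prod_(d <- p) td d = 1.
Proof.
move=> acy tdV; have [n] := ubnP (size p).
elim: n p => // n IHn p pn pT pw.
have [pr|/unreduced_split[p1 [d [p2 ep]]]] := boolP (reduced p).
  by rewrite (acy _ _ pT pr pw) big_nil.
move: pn pT pw; rewrite ep /walk_in all_cat size_cat /= => pn /and4P[pT1 _ _ pT2].
case/is_walk_split=> v w1 /= [dv [_ w2]].
rewrite big_cat !big_cons /= tdV mulVKg -big_cat.
apply: IHn; first by rewrite size_cat; lia.
  by rewrite /walk_in all_cat pT1.
by apply: is_walk_cat w1 _; rewrite dtgt_rev dv in w2.
Qed.

End WalkFacts.

(** * The universal property of the presentation *)

Section Presentation.
Variables (GG : graph_of_groups) (T : spanning_tree GG).
Local Notation src := (dsrc (gend GG)).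
Local Notation tgt := (dtgt (gend GG)).

Definition pi1_dart (d : dart (gedge GG)) : pi1 T := pi1_class T [:: dlet d].

Lemma pi1_vertM v : {morph pi1_vert T (v := v) : g h / g * h}.
Proof.
move=> g h; rewrite -[RHS]/(pi1_mul _ _) pi1_mulE /=.
exact/esym/pi1_classP/Cong_relator/Rel_mul.
Qed.

Lemma pi1_dart_rev d : pi1_dart (drev d) = (pi1_dart d)^-1.
Proof.
apply/esym/mulg1_eq; rewrite -[LHS]/(pi1_mul _ _) pi1_mulE /=.
exact/pi1_classP/Cong_relator/Rel_rev.
Qed.

Lemma pi1_dart_tree d : d.1 \in (T : {set _}) -> pi1_dart d = 1.
Proof. by move=> dT; apply/pi1_classP/Cong_relator/Rel_tree. Qed.

Lemma pi1_dart_conj e b (a : egrp e) :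
  pi1_dart (e, b) * pi1_vert T (emap GG e (~~ b) a) * (pi1_dart (e, b))^-1
  = pi1_vert T (emap GG e b a).
Proof.
rewrite -pi1_dart_rev -[LHS]/(pi1_mul (pi1_mul _ _) _).
rewrite [pi1_mul (pi1_dart _) _]pi1_mulE pi1_mulE.
exact/pi1_classP/Cong_relator/Rel_edge.
Qed.

(** Inverses of generators are generators, so left multiplication by generators reaches every
    element. *)
Lemma pi1_gen_ind (P : pi1 T -> Prop) : P 1 ->
  (forall v (g : vgrp v) x, P x -> P (pi1_vert T g * x)) ->
  (forall d x, P x -> P (pi1_dart d * x)) -> forall x, P x.
Proof.
move=> P1 Pv Pd; apply: pi1W; elim=> [//|[[v g]|d] u IHu].
  have := Pv v g _ IHu; rewrite -[_ * _]/(pi1_mul _ _) pi1_mulE //.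
have := Pd d _ IHu; rewrite -[_ * _]/(pi1_mul _ _) pi1_mulE //.
Qed.

(** Evaluation of words respects each relator, hence the congruence. *)
Lemma pi1_hom (Q : groupType) (rv : forall v : gvert GG, vgrp v -> Q)
    (td : dart (gedge GG) -> Q) :
  (forall v, {morph rv v : x y / x * y}) ->
  (forall d, td (drev d) = (td d)^-1) ->
  (forall d, d.1 \in (T : {set _}) -> td d = 1) ->
  (forall e b (a : egrp e), td (e, b) * rv _ (emap GG e (~~ b) a) * (td (e, b))^-1
      = rv _ (emap GG e b a)) ->
  exists Psi : {multiplicative pi1 T -> Q},
    (forall v (g : vgrp v), Psi (pi1_vert T g) = rv v g)
    /\ (forall d, Psi (pi1_dart d) = td d).
Proof.
move=> rvM tdV tdT tdE.
pose lev (x : letter GG) := match x with inl g => rv _ (tagged g) | inr d => td d end.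
pose ev (u : seq (letter GG)) := \prod_(x <- u) lev x.
have evP u v : pi1_cong T u v -> ev u = ev v.
  elim=> {u v} [u v [w|w g h|d|d dT|e b a]|//|u v _ -> //|v u w _ -> _ -> //|u u' v v' _ eu _ ev'].
  - by rewrite /ev big_seq1 big_nil /= (morph_one (rvM w)).
  - by rewrite /ev !big_cons !big_nil /= !mulg1 rvM.
  - by rewrite /ev !big_cons !big_nil /= mulg1 tdV mulgV.
  - by rewrite /ev big_seq1 big_nil /= tdT.
  - by rewrite /ev !big_cons !big_nil /= !mulg1 tdV mulgA tdE.
  by move: eu ev'; rewrite /ev !big_cat => -> ->.
pose Psi (x : pi1 T) := ev (repr x).
have PsiE u : Psi (pi1_class T u) = ev u by apply/evP/pi1_reprP.
have PsiM : {morph Psi : x y / x * y}.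
  by move=> x y; rewrite PsiE /ev big_cat.
exists (HB.pack_for {multiplicative pi1 T -> Q} Psi
         (isMultiplicative.Build _ _ Psi PsiM)); split=> [v g|d] /=.
  by rewrite PsiE /ev big_seq1.
by rewrite PsiE /ev big_seq1.
Qed.

(** The relations of the tree darts are dispensable: conjugating by the images
    of the walks inside the tree restores them. *)
Lemma pi1_lift (Q : groupType) (rv : forall v : gvert GG, vgrp v -> Q)
    (td : dart (gedge GG) -> Q) :
  (forall v, {morph rv v : x y / x * y}) ->
  (forall d, td (drev d) = (td d)^-1) ->
  (forall e b (a : egrp e), td (e, b) * rv _ (emap GG e (~~ b) a) * (td (e, b))^-1
      = rv _ (emap GG e b a)) ->
  exists (Psi : {multiplicative pi1 T -> Q}) (q : gvert GG -> Q),
    [/\ forall v (g : vgrp v), Psi (pi1_vert T g) = q v * rv v g * (q v)^-1,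
        forall d, Psi (pi1_dart d) = q (src d) * td d * (q (tgt d))^-1
      & forall v, exists p, q v = \prod_(d <- p) td d].
Proof.
move=> rvM tdV tdE; have [Tconn Tacy] := tree_edgesP T.
have [v0 _] : exists v0 : gvert GG, True.
  by have /card_gt0P[v0] := gvert_nonempty GG; exists v0.
have /choice [pa paP] v : exists p, walk_in T p /\ is_walk (gend GG) v0 p v.
  by have [p] := Tconn v0 v; exists p.
pose q v := \prod_(d <- pa v) td d.
(* Going out to the source of [d], along [d], and back from its target is a closed walk inside the
   tree. *)
have qT d : d.1 \in (T : {set _}) -> q (src d) * td d * (q (tgt d))^-1 = 1.
  move=> dT; have [s1 s2] := paP (src d); have [t1 t2] := paP (tgt d).
  pose bk := rev (map (@drev _) (pa (tgt d))).
  have ebk p : \prod_(c <- rev (map (@drev _) p)) td c = (\prod_(c <- p) td c)^-1.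
    elim: p => [|c p IHp]; first by rewrite !big_nil invg1.
    by rewrite /= rev_cons -cats1 big_cat IHp big_seq1 big_cons invgM tdV.
  have wbk u v p : is_walk (gend GG) u p v ->
      is_walk (gend GG) v (rev (map (@drev _) p)) u.
    elim: p u => [u -> //|c p IHp u [<- /IHp h]] /=.
    rewrite rev_cons -cats1; apply: is_walk_cat h _.
    by rewrite /= dtgt_rev.
  have inbk p : walk_in (T : {set _}) p -> walk_in (T : {set _}) (rev (map (@drev _) p)).
    by rewrite /walk_in all_rev all_map.
  have := @tree_walk_trivial _ _ (gend GG) Q T td v0 (pa (src d) ++ d :: bk) Tacy tdV.
  rewrite big_cat big_cons ebk /= mulgA.
  move=> h; apply: h.
    by rewrite /walk_in all_cat -/(walk_in _ _) s1 /= dT; exact: inbk.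
  by apply: is_walk_cat s2 _; split=> //; exact: wbk.
have [|||e b a|Psi [PsiV PsiD]] := @pi1_hom Q (fun v g => q v * rv v g * (q v)^-1)
  (fun d => q (src d) * td d * (q (tgt d))^-1).
- by move=> v x y; rewrite rvM conj_mul.
- by move=> d; rewrite dtgt_rev tdV !invgM invgK mulgA.
- exact: qT.
- rewrite -(tdE e b a) /= !invgM !invgK !mulgA /dsrc /dtgt /=.
  by rewrite !mulgVK.
by exists Psi, q; split=> // v; exists (pa v).
Qed.

End Presentation.

(** * Permutation groups and equivariant bijections *)

(** The inverse is carried as data, so that inversion in the group is a swap of fields; it is
    determined by the forward map, so equality remains pointwise. *)
Record Sym (X : Type) := MkSym {
  sym_fun :> X -> X;
  sym_inv : X -> X;
  sym_funK : cancel sym_fun sym_inv;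
  sym_invK : cancel sym_inv sym_fun
}.

Section SymGroup.
Variable X : Type.

Lemma Sym_ext (s t : Sym X) : (forall x, s x = t x) -> s = t.
Proof.
case: s t => [f f' fK f'K] [g g' gK g'K] /= /funext e; subst g.
have e' : f' = g' by apply/funext => x; rewrite -{1}(g'K x) fK.
by subst g'; congr MkSym; exact: Prop_irrelevance.
Qed.

HB.instance Definition _ := gen_eqMixin (Sym X).
HB.instance Definition _ := gen_choiceMixin (Sym X).

Definition Sym_one : Sym X := @MkSym X id id (fun _ => erefl) (fun _ => erefl).
Definition Sym_mul (s t : Sym X) : Sym X :=
  MkSym (can_comp (@sym_funK _ s) (@sym_funK _ t))
        (can_comp (@sym_invK _ t) (@sym_invK _ s)).
Definition Sym_inv (s : Sym X) : Sym X := MkSym (@sym_invK _ s) (@sym_funK _ s).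

Lemma Sym_mulA : associative Sym_mul.
Proof. by move=> s t u; exact: Sym_ext. Qed.
Lemma Sym_mul1 : left_id Sym_one Sym_mul.
Proof. by move=> s; exact: Sym_ext. Qed.
Lemma Sym_mulr1 : right_id Sym_one Sym_mul.
Proof. by move=> s; exact: Sym_ext. Qed.
Lemma Sym_mulV : left_inverse Sym_one Sym_inv Sym_mul.
Proof. by move=> s; apply: Sym_ext => x; exact: sym_funK. Qed.
Lemma Sym_mulrV : right_inverse Sym_one Sym_inv Sym_mul.
Proof. by move=> s; apply: Sym_ext => x; exact: sym_invK. Qed.

HB.instance Definition _ := isGroup.Build (Sym X)
  Sym_mulA Sym_mul1 Sym_mulr1 Sym_mulV Sym_mulrV.

Lemma Sym_mulE (s t : Sym X) x : (s * t) x = s (t x).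
Proof. by []. Qed.

Lemma Sym_invE (s : Sym X) x y : s x = y -> s^-1 y = x.
Proof. by move=> <-; exact: sym_funK. Qed.

End SymGroup.

(** * Free actions and transversals of their orbits *)

Record free_action (H : groupType) (X : Type) (act : H -> X -> X) : Prop := {
  act_one : forall x, act 1 x = x;
  act_mul : forall g h x, act (g * h) x = act g (act h x);
  act_free : forall g x, act g x = x -> g = 1
}.

Section FreeActions.
Variables (H : groupType) (X : Type).
Implicit Types act : H -> X -> X.

Lemma act_move act h x y : free_action act -> act h x = y -> x = act h^-1 y.
Proof. by move=> fa <-; rewrite -(act_mul fa) mulVg (act_one fa). Qed.

Definition orbit_basis act (J : Type) (F : J -> X) : Prop :=
  (forall x, exists h j, x = act h (F j)) /\
  (forall h j j', act h (F j) = F j' -> j = j').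

Lemma orbit_basis_uniq act J (F : J -> X) h j h' j' :
  free_action act -> orbit_basis act F ->
  act h (F j) = act h' (F j') -> h = h' /\ j = j'.
Proof.
move=> fa [_ inj] e; have e2 : act (h'^-1 * h) (F j) = F j'.
  by rewrite (act_mul fa) e -(act_mul fa) mulVg (act_one fa).
have ej := inj _ _ _ e2; split=> //; rewrite -ej in e2.
by move/(act_free fa)/(congr1 (fun u => h' * u)): e2; rewrite mulVKg mulg1.
Qed.

(** Freeness makes the coordinates [(h, j)] of a point unique; the bijection matches the coordinates
    for the two actions. *)
Lemma equivariant_bijection act act' J (F F' : J -> X) :
  free_action act -> free_action act' ->
  orbit_basis act F -> orbit_basis act' F' ->
  exists s : Sym X, forall h j, s (act h (F j)) = act' h (F' j).
Proof.
move=> fa fa' ba ba'.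
have /choice [c cP] x : exists p : H * J, x = act p.1 (F p.2).
  by have [h [j ->]] := ba.1 x; exists (h, j).
have /choice [c' cP'] x : exists p : H * J, x = act' p.1 (F' p.2).
  by have [h [j ->]] := ba'.1 x; exists (h, j).
have cE h j : c (act h (F j)) = (h, j).
  have := cP (act h (F j)); case: (c _) => h' j' /=.
  by move=> /(orbit_basis_uniq fa ba)[<- <-].
have cE' h j : c' (act' h (F' j)) = (h, j).
  have := cP' (act' h (F' j)); case: (c' _) => h' j' /=.
  by move=> /(orbit_basis_uniq fa' ba')[<- <-].
pose s x := act' (c x).1 (F' (c x).2); pose s' x := act (c' x).1 (F (c' x).2).
have sK : cancel s s' by move=> x; rewrite /s /s' cE' -cP.
have sK' : cancel s' s by move=> x; rewrite /s /s' cE -cP'.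
by exists (MkSym sK sK') => h j /=; rewrite /s cE.
Qed.

End FreeActions.

(** The code bounds the number of classes from above and [fresh] from below, so by Cantor-Bernstein
    they are countably infinite; [phi] lists one representative of each. *)
Lemma enumerate_classes (X : choiceType) (code : X -> nat) (R : X -> X -> Prop)
    (A : X -> Prop) (fresh : nat -> X) :
  injective code -> (forall x, R x x) ->
  (forall x y, R x y -> R y x) -> (forall x y z, R x y -> R y z -> R x z) ->
  (forall x y, R x y -> A x -> A y) ->
  (forall i, A (fresh i)) -> (forall i j, R (fresh i) (fresh j) -> i = j) ->
  exists phi : nat -> X,
    [/\ forall i, A (phi i),
        forall i j, R (phi i) (phi j) -> i = j
      & forall x, A x -> exists i, R x (phi i)].
Proof.
move=> codeI Rr Rs Rt RA fA fI.
pose rep x := xget (fresh 0) [set y | R x y]%classic.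
have repR x : R x (rep x).
  have : [set y | R x y]%classic (rep x) by apply: xgetPex; exists x; exact: Rr.
  by [].
have repE x y : R x y -> rep x = rep y.
  move=> xy; rewrite /rep; congr xget; apply/seteqP; split=> z /= h.
    exact: Rt (Rs _ _ xy) h.
  exact: Rt xy h.
pose B := [set rep x | x in [set x | A x]]%classic.
have cB : (B #= [set: nat]%classic)%card.
  apply: Cantor_Bernstein.
    by apply/countable_injP; exists code => x y _ _; exact: codeI.
  have fB : (range (rep \o fresh) `<=` B)%classic.
    by move=> _ [i _ <-]; exists (fresh i) => //; exact: fA.
  have := subset_card_le fB; rewrite (card_le_eql (inj_card_eq _)) // => i j _ _ /= e.
  by apply: fI; apply: Rt (repR _) _; rewrite e; exact: Rs (repR _).
have [psi [_ psiI psiS]] : exists psi, set_bij B [set: nat]%classic psi by apply/card_set_bijP.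
have /choice [phi phiP] i : exists x, B x /\ psi x = i.
  by have [x ? ?] := psiS i I; exists x.
have repA x : A x -> A (rep x) by exact: RA (repR x).
have rep_rep x : rep (rep x) = rep x by exact/esym/repE/repR.
exists phi; split=> [i|i j e|x Ax].
- by have [[x Ax <-] _] := phiP i; exact: repA.
- have [[x _ ex] <-] := phiP i; have [[y _ ey] <-] := phiP j.
  by move: (repE _ _ e); rewrite -ex -ey !rep_rep => ->.
have [Bi ei] := phiP (psi (rep x)); exists (psi (rep x)).
have Brx : B (rep x) by exists x.
have -> : phi (psi (rep x)) = rep x by apply: (psiI _ _ _ _ ei); rewrite inE.
exact: repR.
Qed.

Section Extension.
Variables (H : groupType) (X : choiceType) (N code : X -> nat) (I : nat -> Prop)
  (fresh : nat -> nat -> X).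
Hypotheses (codeI : injective code) (Nfresh : forall k i, N (fresh k i) = k).

(** The orbits avoiding the prescribed points [a k] are enumerated level by
    level. *)
Lemma leveled_basis (act : H -> X -> X) (a : nat -> X) : free_action act ->
  (forall h x, N (act h x) = N x) ->
  (forall h k l, I k -> I l -> act h (a k) = a l -> k = l) ->
  (forall h k i j, act h (fresh k i) = fresh k j -> i = j) ->
  (forall h k i l, I l -> act h (fresh k i) <> a l) ->
  exists2 phi : nat * nat -> X, forall p, N (phi p) = p.1
    & orbit_basis act (fun j : {k | I k} + nat * nat =>
        match j with inl k => a (sval k) | inr p => phi p end).
Proof.
move=> fa Nact aI fI fa_disj.
pose R x y := exists h, act h x = y.
have Rr x : R x x by exists 1; exact: act_one fa x.
have Rs x y : R x y -> R y x.
  by case=> h e; exists h^-1; exact/esym/(act_move fa).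
have Rt x y z : R x y -> R y z -> R x z.
  by case=> h <- [g <-]; exists (g * h); exact: act_mul fa g h x.
pose A k x := N x = k /\ forall l, I l -> ~ R x (a l).
have RA k x y : R x y -> A k x -> A k y.
  move=> xy [Nx xa]; split; first by case: xy => h <-; rewrite Nact.
  by move=> l Il ya; apply: (xa l Il); exact: Rt xy ya.
have /choice [phi phiP] k : exists phi : nat -> X,
    [/\ forall i, A k (phi i), forall i j, R (phi i) (phi j) -> i = j
      & forall x, A k x -> exists i, R x (phi i)].
  apply: (enumerate_classes (fresh := fresh k) codeI Rr Rs Rt (RA k)).
    by move=> i; split=> // l Il [h]; exact: fa_disj.
  by move=> i j [h]; exact: fI.
exists (fun p => phi p.1 p.2) => [[k i]|]; first by have [/(_ i)[]] := phiP k.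
have phiA k i : A k (phi k i) by have [] := phiP k.
split=> [x|h [[k Ik]|[k i]] [[l Il]|[l j]]] /=.
- have [[l [Il xl]]|nl] := pselect (exists l, I l /\ R x (a l)).
    by have [h e] := Rs _ _ xl; exists h, (inl (exist _ l Il)).
  have [] := phiP (N x) => _ _ /(_ x)[|i /Rs [h e]]; last by exists h, (inr (N x, i)).
  by split=> // l Il xl; apply: nl; exists l.
- move/(aI _ _ _ Ik Il) => e; congr inl; apply: eq_exist.
  exact: e.
- by move=> e; have [_ /(_ k Ik)[]] := phiA l j; apply: Rs; exists h.
- by move=> e; have [_ /(_ l Il)[]] := phiA k i; exists h.
move=> e; have ekl : k = l.
  by rewrite -(proj1 (phiA k i)) -(proj1 (phiA l j)) -e Nact.
subst l; have [_ inj _] := phiP k.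
by rewrite (inj i j) //; exists h.
Qed.

(** Both actions have transversals over the same index type: the prescribed points, and countably
    many further orbits in each level. Matching indices changes levels on prescribed orbits only. *)
Lemma equivariant_extension (act act' : H -> X -> X) (a a' : nat -> X) :
  free_action act -> free_action act' ->
  (forall h x, N (act h x) = N x) -> (forall h x, N (act' h x) = N x) ->
  (forall h k l, I k -> I l -> act h (a k) = a l -> k = l) ->
  (forall h k l, I k -> I l -> act' h (a' k) = a' l -> k = l) ->
  (forall h k i j, act h (fresh k i) = fresh k j -> i = j) ->
  (forall h k i j, act' h (fresh k i) = fresh k j -> i = j) ->
  (forall h k i l, I l -> act h (fresh k i) <> a l) ->
  (forall h k i l, I l -> act' h (fresh k i) <> a' l) ->
  (forall k, I k -> (N (a' k) <= (N (a k)).+1)%N /\ (N (a k) <= (N (a' k)).+1)%N) ->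
  exists s : Sym X,
    [/\ forall h x, s (act h x) = act' h (s x),
        forall k, I k -> s (a k) = a' k
      & forall x, (N (s x) <= (N x).+1)%N /\ (N x <= (N (s x)).+1)%N].
Proof.
move=> fa fa' Na Na' aI aI' fI fI' fd fd' Naa.
have [phi Np bp] := leveled_basis fa Na aI fI fd.
have [phi' Np' bp'] := leveled_basis fa' Na' aI' fI' fd'.
have [s sE] := equivariant_bijection fa fa' bp bp'.
exists s; split=> [h x|k Ik|x].
- have [g [j ->]] := bp.1 x.
  by rewrite -(act_mul fa) !sE (act_mul fa').
- have := sE 1 (inl (exist _ k Ik)).
  by rewrite /= (act_one fa) (act_one fa').
have [g [j ->]] := bp.1 x; rewrite sE Na Na'.
by case: j => [[k Ik]|p] /=; [exact: Naa | rewrite Np Np'].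
Qed.

End Extension.

(** * Actions tracing out a prescribed path *)

(** The product of all vertex groups; it serves both as a common carrier for their actions and as a
    set of labels along paths. *)
Definition vsection (GG : graph_of_groups) : Type := forall v : gvert GG, vgrp v.
HB.instance Definition _ (GG : graph_of_groups) := gen_eqMixin (vsection GG).
HB.instance Definition _ (GG : graph_of_groups) := gen_choiceMixin (vsection GG).

Section PathAction.
Variable GG : graph_of_groups.
Local Notation tgt := (dtgt (gend GG)).

Definition vsection_one : vsection GG := fun v => 1.

Definition vsection_act (v : gvert GG) (g : vgrp v) (s : vsection GG) :
    vsection GG :=
  @dfwith (gvert GG) (fun v => vgrp v : Type) s v (g * s v).

Lemma vsection_act_same v (g : vgrp v) s : vsection_act g s v = g * s v.
Proof. exact: dfwith_in. Qed.

Lemma vsection_act_diff v (g : vgrp v) s w : v != w -> vsection_act g s w = s w.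
Proof. exact: dfwith_out. Qed.

Lemma vsection_actM v (g h : vgrp v) s :
  vsection_act (g * h) s = vsection_act g (vsection_act h s).
Proof.
apply: functional_extensionality_dep => w; have [<-|vw] := eqVneq v w.
  by rewrite !vsection_act_same mulgA.
by rewrite !vsection_act_diff.
Qed.

Lemma vsection_act1 v s : @vsection_act v 1 s = s.
Proof.
apply: functional_extensionality_dep => w; have [<-|vw] := eqVneq v w.
  by rewrite vsection_act_same mul1g.
by rewrite vsection_act_diff.
Qed.

Lemma vsection_code : (forall v : gvert GG, exists f : vgrp v -> nat, injective f) ->
  exists c : vsection GG -> nat, injective c.
Proof.
move=> cnt; have /choice [c cP] v : exists c : vsection GG -> nat,
    forall s t, c s = c t -> s v = t v.
  by have [f fI] := cnt v; exists (fun s => f (s v)) => s t /fI.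
exists (fun s => pickle [ffun v => c v s]) => s t.
move=> /(pcan_inj (@pickleK _)) /ffunP e.
apply: functional_extensionality_dep => v; apply: cP.
by have := e v; rewrite !ffunE.
Qed.

(** Every vertex group acts on its own coordinate of [vsection GG], all of
    them on the same set; the other two coordinates provide levels, and
    infinitely many orbits in each level. *)
Let X : choiceType := (vsection GG * (nat * nat))%type.
Let N (x : X) : nat := x.2.1.
Let act v (g : vgrp v) (x : X) : X := (vsection_act g x.1, x.2).

Lemma path_act_free (H : groupType) v (i : H -> vgrp v) :
  {morph i : x y / x * y} -> injective i ->
  free_action (fun h => act (i h)).
Proof.
move=> iM iI; split=> [x|g h x|g x].
- by rewrite /act (morph_one iM) vsection_act1; case: x.
- by rewrite /act iM vsection_actM.
case: x => s y [/(congr1 (fun s => s v))].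
rewrite vsection_act_same => e; apply: iI; rewrite (morph_one iM).
by apply: (mulIg (s v)); rewrite e mul1g.
Qed.

(** A path crossing the darts [d k] and picking up [c k] in between is traced
    out by the points [x k]; on the prescribed orbits the darts shift the
    level by one, on all others they preserve it. *)
Lemma path_action (P : nat -> Prop) (d : nat -> dart (gedge GG))
    (c : nat -> vsection GG) :
  (forall v : gvert GG, exists f : vgrp v -> nat, injective f) ->
  (forall k e b, P k -> P k.+1 -> d k = (e, b) -> d k.+1 = (e, ~~ b) ->
     forall a, c k (gend GG e (~~ b)) <> emap GG e (~~ b) a) ->
  exists (Y : Type) (lev : Y -> nat) (rv : forall v : gvert GG, vgrp v -> Sym Y)
      (td : dart (gedge GG) -> Sym Y) (x : nat -> Y),
    [/\ [/\ forall v, {morph rv v : g h / g * h},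
            forall v (g : vgrp v), rv v g = 1 -> g = 1,
            forall d, td (drev d) = (td d)^-1
          & forall e b (a : egrp e),
              td (e, b) * rv _ (emap GG e (~~ b) a) * (td (e, b))^-1
              = rv _ (emap GG e b a)],
        forall v g y, lev (rv v g y) = lev y,
        forall d y, (lev (td d y) <= (lev y).+1)%N /\ (lev y <= (lev (td d y)).+1)%N
      & forall k, lev (x k) = k /\
          (P k -> td (d k) (rv _ (c k (tgt (d k))) (x k.+1)) = x k)].
Proof.
move=> /vsection_code[code codeI] red.
pose x k : X := (vsection_one, (k, 0)).
have actM v (g h : vgrp v) y : act (g * h) y = act g (act h y).
  by rewrite /act vsection_actM.
have actK v (g : vgrp v) : cancel (act g) (act g^-1).
  by case=> s y; rewrite -actM mulVg /act vsection_act1.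
have actK' v (g : vgrp v) : cancel (act g^-1) (act g).
  by case=> s y; rewrite -actM mulgV /act vsection_act1.
pose rv v (g : vgrp v) : Sym X := MkSym (actK v g) (actK' v g).
(* The two points that step [k] links across [e]: at the end where the dart starts it is [x k], at
   the other end the labelled [x k.+1]. *)
pose pt b e k := if (d k).2 == b then x k else act (c k (gend GG e b)) (x k.+1).
have code'I : injective (fun y : X => pickle (code y.1, y.2)).
  by move=> [s y] [t z] /(pcan_inj (@pickleK _)) [/codeI -> ->].
have emapM e b : {morph emap GG e b : g h / g * h} by exact: gmulfM.
have free e b := path_act_free (emapM e b) (@emap_inj GG e b).
have same v (g h : vgrp v) k : act g (x k) = act h (x k) -> g = h.
  case=> /(congr1 (fun s => s v)).
  by rewrite !vsection_act_same /vsection_one !mulg1.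
have dE k e : (d k).1 = e -> d k = (e, (d k).2) by case: (d k) => ? ? /= ->.
have {}red b e k a : P k -> P k.+1 -> d k = (e, ~~ b) -> d k.+1 = (e, b) ->
    c k (gend GG e b) <> emap GG e b a.
  by move=> Pk Pk1; case: b a => a dk dk1; [apply: (red k e false)|apply: (red k e true)].
(* Distinct steps across [e] lie in distinct orbits of its edge group: by levels only consecutive
   steps can collide, and then the path backtracks with a label in the edge group. *)
have ptI b e h k l : P k /\ (d k).1 = e -> P l /\ (d l).1 = e ->
    act (emap GG e b h) (pt b e k) = pt b e l -> k = l.
  move=> [Pk /dE dk] [Pl /dE dl]; rewrite /pt.
  have neq (b1 : bool) : (b1 == b) = false -> b1 = ~~ b by case: b1; case: (b).
  case: eqP => [bk|/eqP/negbTE/neq bk]; case: eqP => [bl|/eqP/negbTE/neq bl] E.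
  - exact: (congr1 N E).
  - have ek : k = l.+1 by exact: (congr1 N E).
    subst k;rewrite bk in dk; rewrite bl in dl.
    have ec := same _ _ _ _ E.
    by case: (red b e l h Pl Pk dl dk); exact: esym.
  - have el : k.+1 = l by exact: (congr1 N E).
    subst l; rewrite bk in dk; rewrite bl in dl.
    case: (red b e k h^-1 Pk Pl dk dl); rewrite (morph_inv (emapM e b)).
    have: emap GG e b h * c k (gend GG e b) = 1.
      by apply: (same _ _ _ k.+1); rewrite actM E /act vsection_act1.
    by move=> hc; apply/esym/mulg1_eq.
  by case: (congr1 N E).
have ptN e b k : N (pt b e k) = ((d k).2 != b) + k.
  by rewrite /pt; case: eqP.
(* Index zero is reserved for the path, so these orbits never meet the prescribed ones. *)
pose fresh (k i : nat) : X := (vsection_one, (k, i.+1)).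
have fI v (g : vgrp v) k i j : act g (fresh k i) = fresh k j -> i = j by case.
have fpt v (g : vgrp v) e b k i l : act g (fresh k i) <> pt b e l.
  by rewrite /pt; case: eqP => _ [].
(* The stable letter of [e] has to intertwine the two actions of the edge group, which is exactly
   the edge relation. *)
have /choice [th thP] e : exists s : Sym X,
    [/\ forall h y, s (act (emap GG e false h) y) = act (emap GG e true h) (s y),
        forall k, P k /\ (d k).1 = e -> s (pt false e k) = pt true e k
      & forall y, (N (s y) <= (N y).+1)%N /\ (N y <= (N (s y)).+1)%N].
  apply: (@equivariant_extension _ X N _ (fun k => P k /\ (d k).1 = e) fresh code'I _
    (fun h => act (emap GG e false h)) (fun h => act (emap GG e true h))
    (pt false e) (pt true e)) => //.
  - exact: ptI.
  - exact: ptI.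
  - by move=> h; exact: fI.
  - by move=> h; exact: fI.

  by move=> k _; rewrite !ptN; case: (d k).2 => /=; split; lia.
pose td (f : dart (gedge GG)) : Sym X := if f.2 then th f.1 else (th f.1)^-1.
have tdV f : td (drev f) = (td f)^-1.
  by rewrite /td /=; case: f => e [] //=; rewrite invgK.
have thE e h : th e * rv _ (emap GG e false h) = rv _ (emap GG e true h) * th e.
  by apply: Sym_ext => y; have [+ _ _] := thP e; apply.
exists X, N, rv, td, x; split=> //.
- split=> // [v g h|v g /(congr1 (fun s : Sym X => s (x 0)))|e b a].
  + by apply: Sym_ext => y; exact: actM.
  + by move=> /= e; apply: (same _ _ _ 0); rewrite e /act vsection_act1.
  case: b; rewrite /td /=; first by rewrite thE mulgK.
  by rewrite -mulgA invgK -thE mulKg.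
- move=> [e b] y; rewrite /td /=; have [_ _ thN] := thP e; case: b => //.
  have := thN ((th e)^-1 y); rewrite -[th e ((th e)^-1 y)]/((th e * (th e)^-1) y).
  by rewrite mulgV => -[].
move=> k; split=> // Pk; have [_ thk _] := thP (d k).1.
have := thk k (conj Pk erefl); rewrite /pt /td /dtgt.
case: (d k) => e [] //=.
exact: Sym_invE.
Qed.

End PathAction.

(** * Cyclic reduction *)

(** Countability is what allows the orbits of a path action to be enumerated. *)
Lemma two_ended_countable (G : groupType) : two_ended G ->
  exists f : G -> nat, injective f.
Proof.
move=> /two_endedP[z [r [_ cover]]].
have /choice [f fP] x : exists p : int * nat, x = zexpg z p.1 * nth 1 r p.2.
  have [i [y [yr ->]]] := cover x.
  by exists (i, index y r); rewrite nth_index.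
exists (fun x => pickle (f x)) => x y /(pcan_inj (@pickleK _)) e.
by rewrite (fP x) (fP y) e.
Qed.

Section CyclicReduction.
Variables (GG : graph_of_groups) (T : spanning_tree GG).
Local Notation src := (dsrc (gend GG)).
Local Notation tgt := (dtgt (gend GG)).
Local Notation vert := (pi1_vert T).
Local Notation dart_ := (pi1_dart T).

(** Elements spelled along a walk in the graph, with vertex elements in between; the number counts
    darts only. *)
Inductive path_element : gvert GG -> pi1 T -> gvert GG -> nat -> Prop :=
| Path_one u : path_element u 1 u 0
| Path_vert u (g : vgrp u) x v n :
    path_element u x v n -> path_element u (vert g * x) v n
| Path_dart d x v n :
    path_element (tgt d) x v n -> path_element (src d) (dart_ d * x) v n.+1.

Lemma path_element_cat u x v n y w m : path_element u x v n ->
  path_element v y w m -> path_element u (x * y) w (n + m).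
Proof.
elim=> {u x v n} [u|u g x v n _ IH|d x v n _ IH] py; first by rewrite mul1g.
  by rewrite -mulgA; apply/Path_vert/IH.
by rewrite -mulgA addSn; apply/Path_dart/IH.
Qed.

Lemma path_element_tree p u v : walk_in (T : {set _}) p ->
  is_walk (gend GG) u p v -> path_element u 1 v (size p).
Proof.
elim: p u => [|d p IHp] u /=; first by move=> _ ->; exact: Path_one.
move=> /andP[dT pT] [<- /(IHp _ pT) /Path_dart].
by rewrite pi1_dart_tree ?mulg1.
Qed.

(** Tree darts are trivial, so tree walks can be inserted between the letters of any word to make it
    a closed path. *)
Lemma path_element_all u x : exists n, path_element u x u n.
Proof.
have [Tconn _] := tree_edgesP T.
have conn v w : exists n, path_element v 1 w n.
  by have [p pT pw] := Tconn v w; exists (size p); exact: path_element_tree.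
move: x; apply: pi1_gen_ind => [|v g x [n px]|d x [n px]].
- by exists 0; exact: Path_one.
- have [k p1] := conn u v; have [l p2] := conn v u.
  have := path_element_cat p1 (Path_vert g (path_element_cat p2 px)).
  by rewrite !mul1g; eexists; eassumption.
have [k p1] := conn u (src d); have [l p2] := conn (tgt d) u.
have := path_element_cat p1 (Path_dart (path_element_cat p2 px)).
by rewrite !mul1g; eexists; eassumption.
Qed.

(** Of the section only the value at the target of the dart is read; carrying a whole section avoids
    a dependent pair. *)
Definition path_step : Type := (dart (gedge GG) * vsection GG)%type.
Definition step_darts (p : seq path_step) : seq (dart (gedge GG)) :=
  [seq s.1 | s <- p].

Definition steps_value (Q : groupType) (rv : forall v : gvert GG, vgrp v -> Q)
    (td : dart (gedge GG) -> Q) (p : seq path_step) : Q :=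
  \prod_(s <- p) (td s.1 * rv _ (s.2 (tgt s.1))).

Local Notation value := (steps_value (@pi1_vert GG T) dart_).

Lemma path_element_steps u x v n : path_element u x v n ->
  exists (c : vsection GG) (p : seq path_step),
    [/\ size p = n, is_walk (gend GG) u (step_darts p) v & x = vert (c u) * value p].
Proof.
elim=> {u x v n} [u|u g x v n _ [c [p [sp pw ->]]]|d x v n _ [c [p [sp pw ->]]]].
- exists (@vsection_one GG), [::]; split=> //.
  by rewrite /steps_value big_nil mulg1 /vsection_one (morph_one (@pi1_vertM _ _ _)).
- exists (vsection_act g c), p; split=> //.
  by rewrite vsection_act_same pi1_vertM mulgA.
exists (@vsection_one GG), ((d, c) :: p); split=> //=; first by rewrite sp.
rewrite /steps_value big_cons /= /vsection_one (morph_one (@pi1_vertM _ _ _)).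
by rewrite mul1g mulgA.
Qed.

Lemma steps_path_element p u v : is_walk (gend GG) u (step_darts p) v ->
  path_element u (value p) v (size p).
Proof.
elim: p u => [|[d c] p IHp] u /=.
  by move=> ->; rewrite /steps_value big_nil; exact: Path_one.
move=> [<- /IHp h]; rewrite /steps_value big_cons /= -mulgA.
exact/Path_dart/Path_vert.
Qed.

(** All rotations are tested, so that the passage from the last step back to the first counts
    too. *)
Definition cyclically_reduced (p : seq path_step) : Prop :=
  forall n e b c c' q a, rot n p = [:: ((e, b), c), ((e, ~~ b), c') & q] ->
    c (gend GG e (~~ b)) <> emap GG e (~~ b) a.

Definition pi1_elliptic (x : pi1 T) : Prop :=
  exists v (g : vgrp v) h, x = h * vert g * h^-1.

(** Among all conjugates spelled by closed paths, one with the fewest darts is taken. Without darts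
    it lies in a vertex group; otherwise a removable backtrack would contradict minimality. *)
Lemma cyclic_reduction x : pi1_elliptic x \/
  exists p u h, [/\ (0 < size p)%N, is_walk (gend GG) u (step_darts p) u,
    cyclically_reduced p & x = h * value p * h^-1].
Proof.
pose good n := exists u y h, path_element u y u n /\ x = h * y * h^-1.
have : exists n, `[< good n >].
  have /card_gt0P[u _] := gvert_nonempty GG.
  have [n px] := path_element_all u x; exists n; apply/asboolP.
  by exists u, x, 1; rewrite mul1g invg1 mulg1.
move=> /ex_minnP[n /asboolP[u [y [h [py ex]]]] nmin].
have {py} [c [p [sp pw ey]]] := path_element_steps py.
have [p0|p_gt0] := posnP (size p).
  left; exists u, (c u), h; rewrite ex ey.
  by rewrite (size0nil p0) /steps_value big_nil mulg1.
right; case/lastP: p => [//|p [d c']] in sp pw ey p_gt0 *.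
move: pw; rewrite /step_darts map_rcons -cats1 => /is_walk_split[w w1 /= [dw du]].
(* Conjugation moves the leading vertex element into the label of the last step. *)
pose p' := rcons p (d, fun v => c' v * c v).
have p'w : is_walk (gend GG) u (step_darts p') u.
  rewrite /step_darts map_rcons -cats1; apply: is_walk_cat w1 _.
  by split.
have ep' : x = (h * vert (c u)) * value p' * (h * vert (c u))^-1.
  rewrite ex ey /p' /steps_value -!cats1 !big_cat !big_seq1 /= du pi1_vertM.
  by rewrite !mulgA invgM !mulgA mulgK.
exists p', u, (h * vert (c u)); split=> //; first by rewrite size_rcons.
move=> m e b c1 c2 q a er ec.
have [p1 [p2 [ep er']]] : exists p1 p2, p' = p1 ++ p2 /\ rot m p' = p2 ++ p1.
  by exists (take m p'), (drop m p'); rewrite cat_take_drop.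
move: p'w; rewrite ep /step_darts map_cat => /is_walk_split[v v1 v2].
have := is_walk_cat v2 v1; rewrite -map_cat -er' er /= => -[e1 [_ w3]].
(* After rotating the backtrack to the front, the edge relation removes its two darts. *)
have /nmin : `[< good (size q) >].
  apply/asboolP; exists (gend GG e b), (vert (emap GG e b a) * (vert (c2 (gend GG e b)) * value q)).
  exists (h * vert (c u) * value p1); split.
    apply/Path_vert/Path_vert/steps_path_element.
    by move: w3; rewrite -e1 /dtgt /dsrc /= negbK.
  rewrite ep'; have -> : value p' = value p1 * value p2.
    by rewrite ep /steps_value big_cat.
  have er2 : value (p2 ++ p1) = vert (emap GG e b a) * (vert (c2 (gend GG e b)) * value q).
    rewrite -er' er /steps_value !big_cons /= /dtgt /= negbK ec -(pi1_dart_conj T b a).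
    by rewrite -[(e, ~~ b)]/(drev (e, b)) pi1_dart_rev !mulgA.
  rewrite -er2 /steps_value big_cat /= -!/(steps_value _ _ _).
  by rewrite !invgM !mulgA mulgK.
have := congr1 size er; rewrite size_rot size_rcons -(size_rcons p (d, c')) sp /=.
by move=> -> /ltnW; rewrite ltnn.
Qed.

End CyclicReduction.

(** * Linear parametrizations yield balanced groups *)

Lemma nth_rot (A : Type) (x0 : A) (p : seq A) n i : (n < size p)%N ->
  (i < size p)%N -> nth x0 (rot n p) i = nth x0 p ((n + i) %% size p).
Proof.
move=> np ip; rewrite nth_cat size_drop; case: ltnP => h.
  by rewrite nth_drop modn_small //; lia.
rewrite nth_take; last by lia.
have -> : (n + i = (i - (size p - n)) + size p)%N by lia.
by rewrite modnDr modn_small //; lia.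
Qed.

Section HyperbolicElements.
Variables (GG : graph_of_groups) (T : spanning_tree GG).
Local Notation tgt := (dtgt (gend GG)).
Local Notation value := (steps_value (@pi1_vert GG T) (pi1_dart T)).

(** Along the periodic path that repeats [p], each application of [raw p] lowers the level by [n];
    the length of a permutation is the bound on its level displacement. *)
Lemma hyperbolic_balanced (p : seq (path_step GG)) u :
  (forall v : gvert GG, exists f : vgrp v -> nat, injective f) ->
  (0 < size p)%N -> is_walk (gend GG) u (step_darts p) u -> cyclically_reduced p ->
  forall (h : pi1 T) i j, h * zexpg (value p) i * h^-1 = zexpg (value p) j ->
  `|i|%N = `|j|%N.
Proof.
move=> cnt p0 pw red h i j e.
have [s0 _] : exists s0 : path_step GG, True by case: (p) p0 => // s; exists s.
set n := size p in p0 *.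
pose s k := nth s0 p (k %% n).
have {}red k e' b : True -> True -> (s k).1 = (e', b) -> (s k.+1).1 = (e', ~~ b) ->
    forall a, (s k).2 (gend GG e' (~~ b)) <> emap GG e' (~~ b) a.
  move=> _ _ sk sk1 a ea.
  have kn : (k %% n < n)%N by rewrite ltn_mod.
  (* For [n = 1] the only dart would have to be its own reverse. *)
  have n1 : (1 < n)%N.
    rewrite ltn_neqAle p0 andbT; apply/eqP => n1; move: sk sk1.
    by rewrite /s -n1 !modn1 => -> [] /eqP; case: (b).
  have r0 : nth s0 (rot (k %% n) p) 0 = s k by rewrite nth_rot // addn0 modn_mod.
  have r1 : nth s0 (rot (k %% n) p) 1%N = s k.+1.
    by rewrite nth_rot // modnDml addn1.
  case er : (rot (k %% n) p) r0 r1 => [|[d1 c1] [|[d2 c2] q]] /=.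
  - by have := congr1 size er; rewrite size_rot /= => z; rewrite /n z in p0.
  - by have := congr1 size er; rewrite size_rot /= => z; rewrite /n z in n1.
  move=> r0 r1; rewrite -r0 /= in sk ea; rewrite -r1 /= in sk1.
  by subst d1 d2; apply: (red _ _ _ _ _ _ _ er ea).
have [Y [lev [rv [td [x [[rvM _ tdV tdE] rvlev tdlev xP]]]]]] :=
  @path_action GG (fun _ => True) (fun k => (s k).1) (fun k => (s k).2) cnt red.
have [Psi [q [PsiV PsiD qP]]] := @pi1_lift GG T _ rv td rvM tdV tdE.
have PsiM : {morph Psi : x y / x * y} by exact: gmulfM.
pose raw := steps_value rv td.
have Psi_value v w (r : seq (path_step GG)) : is_walk (gend GG) v (step_darts r) w ->
    Psi (value r) = q v * raw r * (q w)^-1.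
  elim: r v => [|[d c] r IHr] v /=.
    by move=> ->; rewrite /raw /steps_value !big_nil mulg1 mulgV (morph_one PsiM).
  move=> [<- /IHr IH]; move: IH; rewrite /raw /steps_value !big_cons /= !PsiM => ->.
  by rewrite PsiD PsiV !mulgA !mulgVK.
pose len (t : Sym Y) m := forall y, (lev (t y) <= lev y + m)%N /\ (lev y <= lev (t y) + m)%N.
have lenM t1 t2 m1 m2 : len t1 m1 -> len t2 m2 -> len (t1 * t2) (m1 + m2)%N.
  by move=> l1 l2 y; rewrite Sym_mulE; have := l1 (t2 y); have := l2 y; lia.
have lenV t m : len t m -> len t^-1 m.
  move=> l y; have := l (t^-1 y); have -> : t (t^-1 y) = y by exact: sym_invK.
  by case.
have len1 : len 1 0 by move=> y; rewrite !addn0.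
have lenrv v g : len (rv v g) 0 by move=> y; rewrite rvlev !addn0.
have lentd d : len (td d) 1%N by move=> y; rewrite !addn1; exact: tdlev.
have lenq v : exists m, len (q v) m.
  have [w ->] := qP v; elim: w => [|d w [m IHw]]; first by exists 0; rewrite big_nil.
  by exists (1 + m)%N; rewrite big_cons; apply/lenM.
have lenPsi y : exists m, len (Psi y) m.
  move: y; apply: pi1_gen_ind => [|v g y [m IH]|d y [m IH]].
  - by exists 0; rewrite (morph_one PsiM).
  - have [k qk] := lenq v; exists (k + 0 + k + m)%N; rewrite PsiM PsiV.
    by do !apply/lenM => //; apply/lenV.
  have [k qk] := lenq (dsrc (gend GG) d); have [l ql] := lenq (tgt d).
  exists (k + 1 + l + m)%N; rewrite PsiM PsiD.
  by do !apply/lenM => //; apply/lenV.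
have lenraw r : len (raw r) (size r).
  elim: r => [|[d c] r IHr]; rewrite /raw /steps_value ?big_nil ?big_cons //=.
  by rewrite -[(size r).+1]/(1 + 0 + size r)%N; do !apply/lenM => //.
(* Reading a segment of the periodic path carries its end point back to its starting point. *)
have raw_x (r : seq (path_step GG)) k :
    (forall i, (i < size r)%N -> nth s0 r i = s (k + i)) -> raw r (x (k + size r)%N) = x k.
  elim: r k => [|t r IHr] k nr; first by rewrite /raw /steps_value big_nil addn0.
  have /= et := nr 0 isT; rewrite addn0 in et.
  rewrite /raw [steps_value _ _ _]big_cons -/(steps_value rv td r) addnS -addSn.
  rewrite !Sym_mulE IHr; last by move=> l lr; rewrite addSnnS; exact: (nr l.+1).
  by rewrite et; have [_] := xP k; apply.
have raw_p m : raw p (x (n * m + n)%N) = x (n * m)%N.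
  by apply: raw_x => l ln; rewrite /s mulnC modnMDl modn_small.
have raw_pX m k : (raw p ^+ m) (x (n * (k + m))%N) = x (n * k)%N.
  elim: m k => [|m IHm] k; first by rewrite addn0.
  by rewrite expgS Sym_mulE addnS -addSn IHm mulnS addnC raw_p.
have [c lc] := lenPsi h; have [b lb] := lenq u.
(* [Psi] maps [value p] to the conjugate of [raw p] by [q u], so [Psi h] has to be conjugated back
   accordingly. *)
have lt : len ((q u)^-1 * Psi h * q u) (b + c + b)%N by do !apply/lenM => //; apply/lenV.
apply: (@balanced_of_length _ len lenM lenV (raw p) _ i j n _ p0 _ _ lt).
- elim=> [|m IHm]; first by rewrite muln0.
  by rewrite expgS mulnS; apply/lenM => //; exact: lenraw.
- move=> m k /(_ (x (n * m)%N)) [_]; have := raw_pX m 0; rewrite add0n muln0 => ->.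
  by have [-> _] := xP (n * m)%N; have [-> _] := xP 0; rewrite add0n.
have := congr1 Psi e; rewrite !PsiM (morph_inv PsiM) !(morph_zexpg PsiM).
rewrite (Psi_value u u) // -!conj_zexpg => E.
apply: (mulgI (q u)); apply: (mulIg (q u)^-1); rewrite -E.
by rewrite !invgM !invgK !mulgA mulgV mul1g mulgK.
Qed.

End HyperbolicElements.

(** Elements of infinite order are translations, and conjugation changes at most their sign. *)
Lemma balanced_Dinf : balanced Dinf.
Proof.
move=> g /Dinf_infinite_order[a a0 ->] [b s] i j.
rewrite !Dinf_zexpg Dinf_invE !Dinf_mulE => -[].
by case: s; rewrite ?expr0 ?expr1; nia.
Qed.

Section Linear.
Variables (GG : graph_of_groups) (T : spanning_tree GG).
Variable Phi : {multiplicative pi1 T -> Dinf}.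
Hypothesis lin : linear_parametrization Phi.

Let PhiM : {morph Phi : x y / x * y}.
Proof. exact: gmulfM. Qed.

Lemma linear_vert_morph v : {morph (fun g : vgrp v => Phi (pi1_vert T g)) : x y / x * y}.
Proof. by move=> x y; rewrite pi1_vertM PhiM. Qed.

Lemma linear_vert_two_ended (v : gvert GG) : two_ended (vgrp v).
Proof. exact: qi_two_ended (linear_vert_morph (v := v)) (lin.1 v). Qed.

Lemma linear_edge_two_ended (e : gedge GG) : two_ended (egrp e).
Proof.
apply: qi_two_ended (lin.2 e true) => x y.
have emapM : {morph emap GG e true : g h / g * h} by exact: gmulfM.
by rewrite /pi1_edge emapM pi1_vertM PhiM.
Qed.

(** Elliptic elements of infinite order keep it under [Phi], so the claim is inherited from [Dinf];
    the others fall under the level argument. *)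
Lemma linear_balanced : balanced (pi1 T).
Proof.
move=> g og h i j.
have cnt (v : gvert GG) := two_ended_countable (linear_vert_two_ended v).
case: (cyclic_reduction g) => [[v [a [k eg]]]|[p [u [k [p0 pw red eg]]]]] e; last first.
  apply: (hyperbolic_balanced cnt p0 pw red (h := k^-1 * h * k)).
  move: e; rewrite eg -!conj_zexpg => e.
  apply: (mulgI k); apply: (mulIg k^-1); rewrite -e.
  by rewrite !invgM !invgK !mulgA mulgV mul1g mulgK.
have oa : infinite_order a.
  apply: (infinite_order_of_image (@pi1_vertM _ T v)).
  have := infinite_order_conj (h := k^-1) og.
  by rewrite eg invgK !mulgA mulVg mul1g mulgVK.
have o := qi_infinite_order (linear_vert_morph (v := v)) (lin.1 v) oa.
have := congr1 Phi e; rewrite !PhiM (morph_inv PhiM) !(morph_zexpg PhiM).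
apply: balanced_Dinf; rewrite eg !PhiM (morph_inv PhiM).
exact: infinite_order_conj.
Qed.

End Linear.

(** * Twisted cocycles *)

(** Some [z ^+ k] is a power of [a], so the remainders modulo [k], combined with [r], represent all
    cosets of [a]. *)
Lemma cyclic_cover (G : groupType) (a : G) : two_ended G -> infinite_order a ->
  exists r : seq G, forall x, exists i y, y \in r /\ x = zexpg a i * y.
Proof.
move=> tG oa; have [z [r [oz cover]]] := two_endedP tG.
have [k k0 [m m0 e]] := two_ended_power tG oz oa.
exists [seq z ^+ j * y | j <- iota 0 k, y <- r] => x.
have [i [y [yr ->]]] := cover x.
have kz : (k%:Z != 0)%R by rewrite eqz_nat -lt0n.
exists (m * (i %/ k)%Z)%R, (z ^+ `|(i %% k)%Z|%N * y); split.
  apply: allpairs_f => //; rewrite mem_iota.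
  by have := modz_ge0 i kz; have := ltz_mod i kz; lia.
rewrite zexpgM -e mulgA; congr (_ * _).
rewrite -[z ^+ k]/(zexpg z k) -[z ^+ `|_|]/(zexpg z `|(i %% k)%Z|%N).
by rewrite gez0_abs ?modz_ge0 // -zexpgM -zexpgD mulrC -divz_eq.
Qed.

Section TwistedCocycles.
Variables (G : groupType) (eps : G -> bool).
Hypothesis epsM : forall g h, eps (g * h) = eps g (+) eps h.

(** Equivalently, [(c g, eps g)] is a homomorphism to the isometries of the rational line. *)
Definition twisted_cocycle (c : G -> rat) : Prop :=
  forall g h, c (g * h) = (c g + (-1) ^+ eps g * c h)%R.

Lemma eps1 : eps 1 = false.
Proof. by have := epsM 1 1; rewrite mulg1; case: (eps 1). Qed.

Section Facts.
Variable c : G -> rat.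
Hypothesis cM : twisted_cocycle c.

Lemma cocycle1 : c 1 = 0%R.
Proof. by have := cM 1 1; rewrite mulg1 eps1; lra. Qed.

Lemma cocycle_inv g : c g^-1 = (- ((-1) ^+ eps g * c g))%R.
Proof.
have := cM g g^-1; rewrite mulgV cocycle1.
by case: (eps g); rewrite ?expr0 ?expr1; lra.
Qed.

Lemma cocycle_expg g n : eps g = false -> c (g ^+ n) = (n%:R * c g)%R.
Proof.
move=> g0; elim: n => [|n IHn]; first by rewrite cocycle1 mul0r.
by rewrite expgS cM g0 IHn expr0 mul1r -natr1 mulrDl mul1r addrC.
Qed.

Lemma cocycle_zexpg0 z i : c z = 0%R -> c (zexpg z i) = 0%R.
Proof.
move=> cz; have cn n : c (z ^+ n) = 0%R.
  by elim: n => [|n IHn]; rewrite ?cocycle1 // expgS cM IHn cz mulr0 addr0.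
by case: i => n; rewrite /= ?cocycle_inv cn ?mulr0 ?oppr0.
Qed.

(** An element with trivial sign has a positive power among the powers of [z], where [c] vanishes,
    so [c] vanishes on it. A single value at an element of nontrivial sign then determines [c]. *)
Lemma cocycle_coboundary z (r : seq G) :
  (forall x, exists i y, y \in r /\ x = zexpg z i * y) -> c z = 0%R ->
  exists t : rat, forall g, c g = ((1 - (-1) ^+ eps g) * t)%R.
Proof.
move=> cover cz.
have c0 g : eps g = false -> c g = 0%R.
  move=> g0; have [k k0 [i e]] := power_in_cyclic cover g.
  have := cocycle_expg k g0; rewrite e cocycle_zexpg0 // => /esym/eqP.
  by rewrite mulf_eq0 pnatr_eq0 -leqn0 leqNgt k0 => /eqP.
have [[g0 eg0]|no] := pselect (exists g, eps g = true).
  (* This is the fixed point of the reflection given by [g0]. *)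
  exists (c g0 / 2)%R => g; case eg : (eps g); last by rewrite c0 // expr0; lra.
  have -> : g = (g * g0^-1) * g0 by rewrite mulgVK.
  have e0 : eps (g * g0^-1) = false.
    have := epsM (g * g0^-1) g0; rewrite mulgVK eg eg0.
    by case: (eps _).
  by rewrite cM c0 // e0 expr0 expr1; lra.
exists 0%R => g; rewrite mulr0 c0 //; apply/negbTE/negP => eg.
by apply: no; exists g.
Qed.

End Facts.

(** * Averaging over the cosets of a normal cyclic subgroup *)

Section Averaging.
Variables (a : G) (r : seq G).
Hypotheses (oa : infinite_order a)
  (conj_a : forall g, g * a * g^-1 = zexpg a ((-1) ^+ eps g)%R)
  (cover : forall x, exists i y, y \in r /\ x = zexpg a i * y).

Let same x y := `[< exists i, x = zexpg a i * y >].
Let rep x := nth 1 r (find (same x) r).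

Let rep_spec x : rep x \in r /\ exists i, x = zexpg a i * rep x.
Proof.
have hx : has (same x) r.
  have [i [y [yr e]]] := cover x; apply/hasP; exists y => //.
  by apply/asboolP; exists i.
split; first by rewrite mem_nth // -has_find.
by have /asboolP := nth_find 1 hx.
Qed.

Let rep_shift x i : rep (zexpg a i * x) = rep x.
Proof.
rewrite /rep; congr (nth 1 r _); apply: eq_find => y; apply/asboolP/asboolP.
  move=> [j e]; exists (j - i)%R; apply: (mulgI (zexpg a i)).
  by rewrite e mulgA -zexpgD addrC subrK.
by move=> [j ->]; exists (i + j)%R; rewrite zexpgD mulgA.
Qed.

Let rep_rep x : rep (rep x) = rep x.
Proof. by have [_ [i {2}->]] := rep_spec x; rewrite rep_shift. Qed.

(** With [s x] the exponent of [x] relative to its representative, the twisted increment [F g x]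
    depends only on the coset of [x]; its average over the finitely many cosets is the cocycle. *)
Lemma averaged_cocycle : exists2 c, twisted_cocycle c & c a = 1%R.
Proof.
have /choice [s sP] x : exists i, x = zexpg a i * rep x by have [] := rep_spec x.
have s_shift x i : s (zexpg a i * x) = (i + s x)%R.
  apply: (zexpg_inj oa); apply: (mulIg (rep x)).
  by rewrite zexpgD -mulgA -sP -{1}(rep_shift x i) -sP.
have act_shift g i x : g * (zexpg a i * x) = zexpg a ((-1) ^+ eps g * i)%R * (g * x).
  by rewrite zexpgM -conj_a -conj_zexpg !mulgA mulgVK.
pose F g x : int := (s (g * x)%g - (-1) ^+ eps g * s x)%R.
have F_shift g x i : F g (zexpg a i * x) = F g x.
  by rewrite /F act_shift !s_shift; ring.
have F_rep g x : F g (rep x) = F g x by rewrite {2}(sP x) F_shift.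
pose R := undup [seq rep x | x <- r].
have R_rep x : rep x \in R.
  by rewrite mem_undup -rep_rep map_f //; have [] := rep_spec x.
have rep_R x : x \in R -> rep x = x by rewrite mem_undup => /mapP[y _ ->].
have R_perm g : perm_eq [seq rep (g * x) | x <- R] R.
  have u : uniq [seq rep (g * x) | x <- R].
    rewrite map_inj_in_uniq ?undup_uniq // => x y xR yR e.
    rewrite -(rep_R x xR) -(rep_R y yR).
    have -> : x = g^-1 * (zexpg a (s (g * x)%g - s (g * y)%g)%R * (g * y)).
      apply: (mulgI g); rewrite mulVKg {2}(sP (g * y)) -e mulgA -zexpgD subrK.
      exact: sP.
    by rewrite act_shift mulKg rep_shift.
  apply: uniq_perm => //; first exact: undup_uniq.
  apply: (uniq_min_size u _ _).2; last by rewrite size_map.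
  by move=> _ /mapP[x _ ->].
have R0 : ((size R)%:R != 0 :> rat)%R.
  by rewrite pnatr_eq0; have := R_rep 1; case: (R).
exists (fun g => (\sum_(x <- R) F g x)%:~R / (size R)%:R)%R.
  move=> g h; rewrite mulrA -mulrDl; congr (_ / _)%R.
  have -> : ((-1) ^+ eps g = ((-1) ^+ eps g : int)%:~R :> rat)%R.
    by rewrite rmorphXn rmorphN1.
  rewrite -intrM -intrD; congr (_%:~R)%R.
  (* Multiplication by [h] permutes the cosets; after reindexing, the cocycle law holds term by
     term. *)
  have -> : (\sum_(x <- R) F g x)%R = (\sum_(x <- R) F g (h * x)%g)%R.
    by rewrite -(perm_big _ (R_perm h)) big_map; apply: eq_bigr => x _; rewrite F_rep.
  rewrite mulr_sumr -big_split /=; apply: eq_bigr => x _.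
  rewrite /F epsM signr_addb mulgA.
  by move: ((-1) ^+ eps g)%R ((-1) ^+ eps h)%R => p q; ring.
have ea : eps a = false.
  have := conj_a a; rewrite mulgK -{1}[a]zexpg1 => /(zexpg_inj oa).
  by case: (eps a).
rewrite (eq_bigr (fun _ => 1%R)) => [|x _].
  by rewrite big_const_seq count_predT iter_addr_0 natz -pmulrn divff.
by rewrite /F ea -[a]zexpg1 s_shift expr0; ring.
Qed.

End Averaging.
End TwistedCocycles.

(** The group of isometries [x |-> m + (-1) ^ s * x] of the rational line. *)
Definition Qinf : Type := (rat * bool)%type.
HB.instance Definition _ := Choice.on Qinf.

Definition Qinf_mul (x y : Qinf) : Qinf :=
  ((x.1 + (-1) ^+ x.2 * y.1)%R, x.2 (+) y.2).
Definition Qinf_one : Qinf := (0%R, false).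
Definition Qinf_inv (x : Qinf) : Qinf := ((- ((-1) ^+ x.2 * x.1))%R, x.2).

Lemma Qinf_mulA : associative Qinf_mul.
Proof.
move=> [x a] [y b] [z c]; rewrite /Qinf_mul /=; congr pair; last exact: addbA.
by rewrite signr_addb; ring.
Qed.
Lemma Qinf_mul1 : left_id Qinf_one Qinf_mul.
Proof. by case=> x a; rewrite /Qinf_mul /= add0r mul1r. Qed.
Lemma Qinf_mulr1 : right_id Qinf_one Qinf_mul.
Proof. by case=> x a; rewrite /Qinf_mul /= mulr0 addr0 addbF. Qed.
Lemma Qinf_mulV : left_inverse Qinf_one Qinf_inv Qinf_mul.
Proof. by case=> x a; rewrite /Qinf_mul /= addNr addbb. Qed.
Lemma Qinf_mulrV : right_inverse Qinf_one Qinf_inv Qinf_mul.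
Proof. by case=> x a; rewrite /Qinf_mul /= mulrN signrMK subrr addbb. Qed.

HB.instance Definition _ := isGroup.Build Qinf
  Qinf_mulA Qinf_mul1 Qinf_mulr1 Qinf_mulV Qinf_mulrV.

Lemma Qinf_mulE (a b : rat) (s t : bool) :
  ((a, s) : Qinf) * ((b, t) : Qinf) = (a + (-1) ^+ s * b, s (+) t)%R :> Qinf.
Proof. by []. Qed.

Lemma Qinf_invE (a : rat) (s : bool) :
  ((a, s) : Qinf)^-1 = (- ((-1) ^+ s * a), s)%R :> Qinf.
Proof. by []. Qed.

(** * A normal infinite cyclic subgroup *)

Section Commensurability.
Variable G : groupType.
Implicit Types x y z h : G.

Definition commensurable x y : Prop :=
  exists i j : int, [/\ (i != 0)%R, (j != 0)%R & zexpg x i = zexpg y j].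

Lemma commensurable_refl x : commensurable x x.
Proof. by exists 1%R, 1%R. Qed.

Lemma commensurable_trans x y z :
  commensurable x y -> commensurable y z -> commensurable x z.
Proof.
move=> [i [j [i0 j0 e]]] [k [l [k0 l0 e']]].
exists (i * k)%R, (l * j)%R; split; rewrite ?mulf_neq0 //.
by rewrite !zexpgM e -e' -!zexpgM mulrC.
Qed.

Lemma commensurable_conj h x y :
  commensurable x y -> commensurable (h * x * h^-1) (h * y * h^-1).
Proof.
by move=> [i [j [i0 j0 e]]]; exists i, j; split; rewrite // -!conj_zexpg e.
Qed.

Lemma commensurable_morph (H : groupType) (f : H -> G) (x y : H) :
  {morph f : x y / x * y} -> two_ended H -> infinite_order x -> infinite_order y ->
  commensurable (f x) (f y).
Proof.
move=> fM tH ox oy; have [k k0 [i i0 e]] := two_ended_power tH ox oy.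
exists k%:Z%R, i; split; rewrite ?eqz_nat -?lt0n //.
by rewrite zexpg_nat -(morph_expg fM) e (morph_zexpg fM).
Qed.

End Commensurability.

(** The product of the individual exponents works for all of them. *)
Lemma common_exponent (A : eqType) (R : nat -> A -> Prop) (L : seq A) :
  (forall n m x, (0 < m)%N -> R n x -> R (n * m)%N x) ->
  (forall x, x \in L -> exists2 n, (0 < n)%N & R n x) ->
  exists2 n, (0 < n)%N & forall x, x \in L -> R n x.
Proof.
move=> Rm; elim: L => [|x L IHL] RL; first by exists 1%N.
have [n n0 nx] := RL x (mem_head _ _).
have [y yL|m m0 mL] := IHL; first by apply: RL; rewrite inE yL orbT.
exists (n * m)%N => [|y]; first by rewrite muln_gt0 n0.
rewrite inE => /orP[/eqP ->|/mL]; first exact: Rm.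
by rewrite mulnC; apply: Rm.
Qed.

(** * Two-ended vertex and edge groups inside the fundamental group *)

Section Decomposable.
Variables (GG : graph_of_groups) (T : spanning_tree GG).
Local Notation src := (dsrc (gend GG)).
Local Notation tgt := (dtgt (gend GG)).
Local Notation vert := (pi1_vert T).
Local Notation dart_ := (pi1_dart T).

Hypothesis vert_two_ended : forall v : gvert GG, two_ended (vgrp v).

(** A path action without prescribed points represents the vertex groups faithfully, and the induced
    homomorphism restricts to conjugates of these representations. *)
Lemma pi1_vert_inj (v : gvert GG) : injective (pi1_vert T (v := v)).
Proof.
suff ker (g : vgrp v) : vert g = 1 -> g = 1.
  move=> g h e; apply: (mulIg h^-1); rewrite mulgV; apply: ker.
  by rewrite pi1_vertM (morph_inv (@pi1_vertM _ T v)) e mulgV.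
have [[d0 _]|nod] := pselect (exists d : dart (gedge GG), True).
  have cnt (w : gvert GG) := two_ended_countable (vert_two_ended w).
  have [//|Y [lev [rv [td [x [[rvM rvI tdV tdE] _ _ _]]]]]] :=
    @path_action GG (fun _ => False) (fun _ => d0) (fun _ => @vsection_one GG) cnt.
  have [Psi [q [PsiV _ _]]] := @pi1_lift GG T _ rv td rvM tdV tdE.
  have PsiM : {morph Psi : x y / x * y} by exact: gmulfM.
  move=> /(congr1 Psi); rewrite PsiV (morph_one PsiM) => e.
  by apply: rvI; apply: (mulgI (q v)); apply: (mulIg (q v)^-1); rewrite e mulg1 mulgV.
(* Without darts there are no edge relations to check; this map is the identity on the group at [v]
   and trivial on the others. *)
have [|||e|Psi [PsiV _]] := @pi1_hom GG T (vgrp v)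
    (fun w (g : vgrp w) => vsection_act g (@vsection_one GG) v) (fun=> 1).
- move=> w a b; have [wv|wv] := eqVneq w v.
    by subst w; rewrite !vsection_act_same /vsection_one !mulg1.
  by rewrite !vsection_act_diff // /vsection_one mulg1.
- by move=> d; rewrite invg1.
- by [].
- by case: nod; exists (e, true).
have PsiM : {morph Psi : x y / x * y} by exact: gmulfM.
move=> /(congr1 Psi); rewrite PsiV vsection_act_same mulg1 => ->.
exact: morph_one PsiM.
Qed.

Hypothesis edge_two_ended : forall e : gedge GG, two_ended (egrp e).

(** Finite generation, phrased as an induction principle over [L]. *)
Lemma pi1_finitely_generated : exists L : seq (pi1 T), forall P : pi1 T -> Prop,
  P 1 -> (forall x y, P x -> P y -> P (x * y)) -> (forall x, P x -> P x^-1) ->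
  (forall x, x \in L -> P x) -> forall x, P x.
Proof.
have /choice [gens gensP] v : exists s : seq (pi1 T), forall P : pi1 T -> Prop,
    P 1 -> (forall x y, P x -> P y -> P (x * y)) -> (forall x, P x -> P x^-1) ->
    (forall x, x \in s -> P x) -> forall g : vgrp v, P (vert g).
  have [z [r [_ cover]]] := two_endedP (vert_two_ended v).
  have vM := @pi1_vertM _ T v.
  exists [seq vert g | g <- z :: r] => P P1 PM PV Ps g.
  have [i [y [yr ->]]] := cover g; rewrite vM (morph_zexpg vM).
  apply: (PM); last by apply: Ps; rewrite map_f // inE yr orbT.
  have Pz n : P (vert z ^+ n).
    elim: n => [//|n IHn]; rewrite expgS; apply: (PM) => //.
    by apply: Ps; rewrite map_f ?mem_head.
  by case: i => n; [exact: Pz | exact/PV/Pz].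
exists (flatten [seq gens v | v <- enum (gvert GG)] ++
        [seq dart_ d | d <- enum {: dart (gedge GG)}]) => P P1 PM PV PL.
apply: pi1_gen_ind => // [v g x Px|d x Px]; apply: (PM) => //.
  apply: gensP => // y ys; apply: PL; rewrite mem_cat; apply/orP; left.
  by apply/flatten_mapP; exists v; rewrite // mem_enum.
by apply: PL; rewrite mem_cat map_f ?orbT // mem_enum.
Qed.

(** Tree darts are trivial, so the two images of an edge element coincide; an infinite order edge
    element thus links neighbouring vertex groups along a tree walk. *)
Lemma pi1_elliptic_commensurable v w (g : vgrp v) (h : vgrp w) :
  infinite_order g -> infinite_order h -> commensurable (vert g) (vert h).
Proof.
have vM u := @pi1_vertM _ T u.
have loc u (a b : vgrp u) : infinite_order a -> infinite_order b ->
    commensurable (vert a) (vert b).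
  exact: commensurable_morph.
have [Tconn _] := tree_edgesP T; have [p pT pw] := Tconn v w.
elim: p v pT pw g => [|d p IHp] v /=; first by move=> _ -> g; exact: loc.
move=> /andP[dT pT] [<- pw] g og oh.
case: d dT pw g og => e b dT pw g og.
have [c [_ [oc _]]] := two_endedP (edge_two_ended e).
have oc' b' : infinite_order (emap GG e b' c).
  apply: infinite_order_image oc; last exact: emap_inj.
  by move=> x y; exact: gmulfM.
apply: commensurable_trans (loc _ _ _ og (oc' b)) _.
rewrite -pi1_dart_conj pi1_dart_tree // mul1g invg1 mulg1.
exact: (IHp _ pT pw _ (oc' (~~ b)) oh).
Qed.

(** By induction on [h]: before each generator acts, the element is replaced by a commensurable one
    that this generator conjugates into a vertex group. *)
Lemma pi1_conj_commensurable v (g : vgrp v) : infinite_order g ->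
  forall h : pi1 T, commensurable (h * vert g * h^-1) (vert g).
Proof.
move=> og; have vM u := @pi1_vertM _ T u.
have conjA (x y z : pi1 T) : (x * y) * z * (x * y)^-1 = x * (y * z * y^-1) * x^-1.
  by rewrite invgM !mulgA.
apply: pi1_gen_ind => [|w a h IH|[e b] h IH].
- by rewrite mul1g invg1 mulg1; exact: commensurable_refl.
- rewrite conjA; apply: commensurable_trans (commensurable_conj _ IH) _.
  have [z [_ [oz _]]] := two_endedP (vert_two_ended w).
  apply: commensurable_trans (commensurable_conj _ (pi1_elliptic_commensurable og oz)) _.
  rewrite -(morph_inv (vM w)) -!vM.
  exact: pi1_elliptic_commensurable (infinite_order_conj oz) og.
rewrite conjA; apply: commensurable_trans (commensurable_conj _ IH) _.
have [c [_ [oc _]]] := two_endedP (edge_two_ended e).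
have oc' b' : infinite_order (emap GG e b' c).
  apply: infinite_order_image oc; last exact: emap_inj.
  by move=> x y; exact: gmulfM.
apply: commensurable_trans
  (commensurable_conj _ (pi1_elliptic_commensurable og (oc' (~~ b)))) _.
rewrite pi1_dart_conj; exact: pi1_elliptic_commensurable (oc' b) og.
Qed.

Hypothesis bal : balanced (pi1 T).

(** By balancedness a suitable power of any infinite order element of a vertex
    group generates a normal subgroup; a further power lies in the images of
    all vertex and edge groups. *)
Lemma normal_cyclic_subgroup : exists zeta : pi1 T,
  [/\ infinite_order zeta,
      forall h, exists b : bool, h * zeta * h^-1 = zexpg zeta ((-1) ^+ b)%R,
      forall v, exists a : vgrp v, vert a = zeta
    & forall e b, exists c : egrp e, vert (emap GG e b c) = zeta].
Proof.
have /card_gt0P[v0 _] := gvert_nonempty GG.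
have [z0 [_ [oz0 _]]] := two_endedP (vert_two_ended v0).
pose z := vert z0.
have oz : infinite_order z.
  exact (infinite_order_image (@pi1_vertM _ T v0) (@pi1_vert_inj v0) oz0).
have oX n : (0 < n)%N -> infinite_order (z ^+ n).
  move=> n0; rewrite -zexpg_nat; apply: infinite_order_pow => //; lia.
pose R n h := exists b : bool, h * z ^+ n * h^-1 = zexpg (z ^+ n) ((-1) ^+ b)%R.
have Rmul n m h : (0 < m)%N -> R n h -> R (n * m)%N h.
  move=> _ [b e]; exists b; rewrite expgnA conj_expg e.
  by rewrite -[zexpg (z ^+ n) _ ^+ m]/(zexpg _ m) -[(z ^+ n) ^+ m]/(zexpg _ m) -!zexpgM mulrC.
have Rex h : exists2 n, (0 < n)%N & R n h.
  have [i [j [i0 j0 e]]] := pi1_conj_commensurable oz0 h.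
  (* Balancedness turns commensurability into equality of exponents up to sign. *)
  have eij : `|i|%N = `|j|%N by apply: (bal oz (h := h)); rewrite conj_zexpg.
  exists `|i|%N; first by rewrite absz_gt0.
  rewrite -/z -conj_zexpg in e.
  have [b eb] : exists b : bool, j = ((-1) ^+ b * i)%R.
    have := eqr_norm2 j i; rewrite -!abszE eij eqxx => /esym/orP[] /eqP ->.
      by exists false; rewrite mul1r.
    by exists true; rewrite mulN1r.
  have ei : z ^+ `|i|%N = zexpg (zexpg z i) ((-1) ^+ (i < 0)%R)%R.
    by rewrite -zexpg_nat -zexpgM abszE normrEsign mulrC.
  exists b; rewrite {1}ei conj_zexpg e eb -zexpg_nat -!zexpgM; congr zexpg.
  by rewrite abszE normrEsign mulrAC -mulrA mulrC.
have [L LP] := pi1_finitely_generated.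
(* One exponent serves the finitely many generators, hence the whole group. *)
have [n n0 nL] := common_exponent Rmul (fun h (_ : h \in L) => Rex h).
have nR : forall h, R n h.
  apply: LP nL => [|x y [b ex] [c ey]|x [b ex]].
  - by exists false; rewrite mul1g invg1 mulg1 zexpg1.
  - exists (b (+) c); rewrite invgM !mulgA -(mulgA x y) -(mulgA x (y * _)) ey.
    by rewrite conj_zexpg ex -zexpgM signr_addb.
  exists b; apply: (mulgI x); apply: (mulIg x^-1).
  rewrite conj_zexpg ex -zexpgM -signr_addb addbb zexpg1 invgK.
  by rewrite !mulgA mulgV mul1g mulgK.
(* The remaining task is a common further power lying in all of the finitely many vertex and edge
   groups. *)
pose Rv m v := exists a : vgrp v, vert a = (z ^+ n) ^+ m.
pose Re m (d : dart (gedge GG)) := exists c : egrp d.1, vert (emap GG d.1 d.2 c) = (z ^+ n) ^+ m.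
have comm_pow (x : pi1 T) : commensurable (z ^+ n) x ->
    exists2 m, (0 < m)%N & exists i, (z ^+ n) ^+ m = zexpg x i.
  move=> [i [j [i0 j0 e]]]; exists `|i|%N; first by rewrite absz_gt0.
  exists (j * (-1) ^+ (i < 0)%R)%R.
  by rewrite -[_ ^+ `|i|]zexpg_nat zexpgM -e -zexpgM abszE normrEsign mulrC.
have comm_n w (g : vgrp w) : infinite_order g -> commensurable (z ^+ n) (vert g).
  move=> og; rewrite -(morph_expg (@pi1_vertM _ T v0)).
  apply: pi1_elliptic_commensurable og; rewrite -zexpg_nat.
  by apply: infinite_order_pow => //; lia.
have [mv mv0 mvP] : exists2 m, (0 < m)%N & forall v, v \in enum (gvert GG) -> Rv m v.
  apply: common_exponent => [m k v _ [a ea]|v _].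
    by exists (a ^+ k); rewrite (morph_expg (@pi1_vertM _ T v)) ea -expgnA.
  have [g [_ [og _]]] := two_endedP (vert_two_ended v).
  have [m m0 [i e]] := comm_pow _ (comm_n _ _ og).
  by exists m => //; exists (zexpg g i); rewrite (morph_zexpg (@pi1_vertM _ T v)) e.
have emapM e b : {morph emap GG e b : g h / g * h} by exact: gmulfM.
have [me me0 meP] : exists2 m, (0 < m)%N &
    forall d, d \in enum {: dart (gedge GG)} -> Re m d.
  apply: common_exponent => [m k [e b] _ [a /= ea]|[e b] _].
    exists (a ^+ k); rewrite /= (morph_expg (emapM e b)).
    by rewrite (morph_expg (@pi1_vertM _ T _)) ea -expgnA.
  have [g [_ [og _]]] := two_endedP (edge_two_ended e).
  have oe : infinite_order (emap GG e b g).
    exact (infinite_order_image (emapM e b) (@emap_inj GG e b) og).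
  have [m m0 [i ei]] := comm_pow _ (comm_n _ _ oe).
  exists m => //; exists (zexpg g i); rewrite /= (morph_zexpg (emapM e b)).
  by rewrite (morph_zexpg (@pi1_vertM _ T _)) ei.
exists (z ^+ (n * (mv * me))); split.
- by apply: oX; rewrite !muln_gt0 n0 mv0.
- by move=> h; apply: Rmul (nR h); rewrite muln_gt0 mv0.
- move=> v; have [|a ea] := mvP v; first by rewrite mem_enum.
  exists (a ^+ me); rewrite (morph_expg (@pi1_vertM _ T v)) ea.
  by rewrite -!expgnA mulnA.
move=> e b; have [|a /= ea] := meP (e, b); first by rewrite mem_enum.
exists (a ^+ mv); rewrite (morph_expg (emapM e b)) (morph_expg (@pi1_vertM _ T _)) ea.
by rewrite -!expgnA (mulnC mv) mulnA.
Qed.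

End Decomposable.

(** * Parametrizing balanced groups *)

Section Parametrization.
Variables (GG : graph_of_groups) (T : spanning_tree GG).
Local Notation vert := (pi1_vert T).
Local Notation dart_ := (pi1_dart T).

Hypotheses (vert_two_ended : forall v : gvert GG, two_ended (vgrp v))
  (edge_two_ended : forall e : gedge GG, two_ended (egrp e))
  (bal : balanced (pi1 T)).

Lemma rational_parametrization :
  exists (Psi : {multiplicative pi1 T -> Qinf}) (zeta : pi1 T),
    [/\ exists2 q : rat, (q != 0)%R & Psi zeta = (q, false),
        forall v, exists a : vgrp v, vert a = zeta
      & forall e b, exists c : egrp e, vert (emap GG e b c) = zeta].
Proof.
have [zeta [oz norm inV inE]] := normal_cyclic_subgroup vert_two_ended edge_two_ended bal.
(* The sign by which conjugation acts on [zeta] is a character. *)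
have /choice [eps epsP] := norm.
have sign_inj (b c : bool) : ((-1) ^+ b = (-1) ^+ c :> int)%R -> b = c.
  by case: b; case: c.
have epsM g h : eps (g * h) = eps g (+) eps h.
  apply: sign_inj; apply: (zexpg_inj oz); rewrite -epsP signr_addb invgM.
  rewrite !mulgA -(mulgA g h) -(mulgA g (h * _)) epsP conj_zexpg epsP.
  by rewrite -zexpgM.
have vM v := @pi1_vertM _ T v.
have vI v := @pi1_vert_inj _ T vert_two_ended v.
have /choice_dep [a aP] := inV.
have oa v : infinite_order (a v).
  by apply: (infinite_order_of_image (vM v)); rewrite aP.
pose epsv v (g : vgrp v) := eps (vert g).
have epsvM v (g h : vgrp v) : epsv v (g * h) = epsv v g (+) epsv v h.
  by rewrite /epsv vM epsM.
have conj_a v (g : vgrp v) : g * a v * g^-1 = zexpg (a v) ((-1) ^+ epsv v g)%R.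
  by apply: vI; rewrite !vM (morph_inv (vM v)) (morph_zexpg (vM v)) aP epsP.
have /choice_dep [c cP] v : exists c : vgrp v -> rat,
    twisted_cocycle (epsv v) c /\ c (a v) = 1%R.
  have [r cover] := cyclic_cover (vert_two_ended v) (oa v).
  have [c cM c1] := averaged_cocycle (epsvM v) (oa v) (conj_a v) cover.
  by exists c.
have emapM e b : {morph emap GG e b : g h / g * h} by exact: gmulfM.
have dart_conj e (g : egrp e) := pi1_dart_conj T true g.
have eps_edge e (g : egrp e) :
    epsv _ (emap GG e false g) = epsv _ (emap GG e true g).
  rewrite /epsv -(dart_conj e) !epsM.
  have -> : eps (dart_ (e, true))^-1 = eps (dart_ (e, true)).
    have := epsM (dart_ (e, true)) (dart_ (e, true))^-1.
    rewrite mulgV (eps1 epsM); by case: (eps _); case: (eps _).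
  by case: (eps _); case: (eps _).
(* On the edge group the two cocycles, aligned by the sign of the stable letter, agree at the
   preimage of [zeta]; their difference is thus a coboundary. *)
have /choice [t tP] e : exists t : rat, forall g : egrp e,
    (c _ (emap GG e true g) - (-1) ^+ eps (dart_ (e, true)) * c _ (emap GG e false g)
     = (1 - (-1) ^+ epsv _ (emap GG e true g)) * t)%R.
  have [w ew] := inE e true.
  have etw : emap GG e true w = a _ by apply: vI; rewrite ew aP.
  have oe : infinite_order w.
    by apply: (infinite_order_of_image (emapM e true)); rewrite etw.
  have [r cover] := cyclic_cover (edge_two_ended e) oe.
  pose epse g := epsv _ (emap GG e true g).
  have epseM g h : epse (g * h) = epse g (+) epse h.
    by rewrite /epse emapM epsvM.
  apply: (cocycle_coboundary epseM _ cover) => [g h|].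
    rewrite !emapM (cP _).1 (cP _).1 eps_edge -/(epse g).
    by move: ((-1) ^+ eps _)%R ((-1) ^+ epse g)%R => p q; ring.
  rewrite etw (cP _).2.
  have -> : emap GG e false w = zexpg (a _) ((-1) ^+ eps (dart_ (e, true)))%R.
    apply: vI; rewrite (morph_zexpg (vM _)) aP.
    apply: (mulgI (dart_ (e, true))); apply: (mulIg (dart_ (e, true))^-1).
    rewrite dart_conj etw aP conj_zexpg epsP -zexpgM -signr_addb addbb.
    by rewrite zexpg1.
  have ea v : epsv v (a v) = false.
    apply: sign_inj; apply: (zexpg_inj (oa v)).
    by rewrite -conj_a mulgK zexpg1.
  case: (eps _); rewrite ?expr0 ?expr1; last by rewrite zexpg1 (cP _).2; lra.
  by rewrite zexpgN zexpg1 (cocycle_inv (epsvM _) (cP _).1) ea (cP _).2 expr0; lra.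
pose rv v (g : vgrp v) : Qinf := (c v g, epsv v g).
(* The translation part [t e] absorbs this coboundary in the edge relation. *)
pose tau e : Qinf := (t e, eps (dart_ (e, true))).
pose td (d : dart (gedge GG)) : Qinf := if d.2 then tau d.1 else (tau d.1)^-1.
have rvM v : {morph rv v : g h / g * h}.
  by move=> g h; rewrite /rv (cP v).1 epsvM.
have tdV d : td (drev d) = (td d)^-1.
  by case: d => e []; rewrite /td //= invgK.
have tauE e (g : egrp e) :
    tau e * rv _ (emap GG e false g) * (tau e)^-1 = rv _ (emap GG e true g).
  rewrite /tau /rv Qinf_invE !Qinf_mulE eps_edge; congr pair; last first.
    by case: (eps _); case: (epsv _ _).
  have := tP e g; case: (eps _); case: (epsv _ _);
    rewrite ?expr0 ?expr1 /= ?expr0 ?expr1; lra.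
have [|Psi [q [PsiV _ _]]] := @pi1_lift GG T _ rv td rvM tdV.
  move=> e [] g; rewrite /td /=; first exact: tauE.
  by rewrite -tauE invgK !mulgA mulVg mul1g mulgVK.
have [v0 _] : exists v0 : gvert GG, True.
  by have /card_gt0P[v0] := gvert_nonempty GG; exists v0.
exists Psi, zeta; split=> //.
have PsiM : {morph Psi : x y / x * y} by exact: gmulfM.
rewrite -(aP v0) PsiV /rv (cP v0).2.
have -> : epsv v0 (a v0) = false.
  apply: sign_inj; apply: (zexpg_inj (oa v0)).
  by rewrite -conj_a mulgK zexpg1.
(* Conjugation by [q v0] changes the unit translation at most by a sign. *)
case: (q v0) => x s; exists ((-1) ^+ s)%R; first by rewrite signr_eq0.
rewrite Qinf_invE !Qinf_mulE addbF addbb; congr pair.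
by case: (s); rewrite ?expr0 ?expr1 /=; lra.
Qed.

(** A common denominator of the translation parts of finitely many generators clears those of all
    elements, and scaling the line by it preserves the group law. *)
Lemma integral_parametrization :
  exists (Phi : {multiplicative pi1 T -> Dinf}) (zeta : pi1 T),
    [/\ infinite_order (Phi zeta),
        forall v, exists a : vgrp v, vert a = zeta
      & forall e b, exists c : egrp e, vert (emap GG e b c) = zeta].
Proof.
have [Psi [zeta [[q q0 Pz] inV inE]]] := rational_parametrization.
have PsiM : {morph Psi : x y / x * y} by exact: gmulfM.
pose R n (x : pi1 T) := exists k : int, (n%:R * (Psi x).1 = k%:~R)%R.
have [L LP] := pi1_finitely_generated T vert_two_ended.
have [|x _|n n0 nL] := @common_exponent _ R L.
- move=> n m x _ [k e]; exists (m%:Z * k)%R.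
  by rewrite natrM mulrAC e intrM mulrC.
- exists `|denq (Psi x).1|%N; first by rewrite absz_gt0 denq_neq0.
  exists (numq (Psi x).1).
  by rewrite natr_absz gtr0_norm ?denq_gt0 // mulrC -numqE.
have nR : forall x, R n x.
  apply: LP nL => [|x y [k ek] [l el]|x [k ek]].
  - by exists 0%R; rewrite (morph_one PsiM) mulr0.
  - exists (k + (-1) ^+ (Psi x).2 * l)%R; rewrite PsiM.
    rewrite -[Psi x * Psi y]/(Qinf_mul _ _) /= mulrDr ek mulrCA el.
    by rewrite intrD rmorphM rmorphXn rmorphN1.
  exists (- ((-1) ^+ (Psi x).2 * k))%R; rewrite (morph_inv PsiM).
  rewrite -[(Psi x)^-1]/(Qinf_inv _) /= mulrN mulrCA ek.
  by rewrite rmorphN rmorphM rmorphXn rmorphN1.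
have /choice [k kP] := nR.
pose phi x : Dinf := (k x, (Psi x).2).
have phiM : {morph phi : x y / x * y}.
  move=> x y; rewrite /phi Dinf_mulE PsiM; congr pair.
  apply: (@intr_inj rat); rewrite -kP PsiM intrD -(kP x).
  have -> : (((-1) ^+ (Psi x).2 * k y)%:~R = (-1) ^+ (Psi x).2 * (n%:R * (Psi y).1) :> rat)%R.
    by rewrite kP rmorphM rmorphXn rmorphN1.
  rewrite -[Psi x * Psi y]/(Qinf_mul _ _) /=.
  move: (Psi x).1 (Psi y).1 ((-1) ^+ (Psi x).2)%R => p q' r; ring.
exists (HB.pack_for {multiplicative pi1 T -> Dinf} phi
          (isMultiplicative.Build _ _ phi phiM)), zeta; split=> //=.
rewrite /phi Pz; apply: Dinf_translation_order.
rewrite -(intr_eq0 rat) -kP Pz mulf_neq0 // pnatr_eq0; lia.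
Qed.

(** Each vertex and edge group contains a preimage of [zeta], whose image under [Phi] has infinite
    order; for two-ended groups this suffices for a quasi-isometry. *)
Lemma balanced_linear_parametrization :
  exists Phi : {multiplicative pi1 T -> Dinf}, linear_parametrization Phi.
Proof.
have [Phi [zeta [oz inV inE]]] := integral_parametrization.
have PhiM : {morph Phi : x y / x * y} by exact: gmulfM.
exists Phi; split=> [v|e b].
  have [a ea] := inV v.
  apply: (two_ended_qi (u := a)) => //; last by rewrite ea.
  by move=> x y; rewrite pi1_vertM PhiM.
have [c ec] := inE e b.
have emapM : {morph emap GG e b : g h / g * h} by exact: gmulfM.
apply: (two_ended_qi (u := c)) => //; last by rewrite /pi1_edge ec.
by move=> x y; rewrite /pi1_edge emapM pi1_vertM PhiM.
Qed.

End Parametrization.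

Theorem theorem1p5 (G : groupType) :
  linearly_parametrizable G <-> two_ended_2_decomposable G /\ balanced G.
Proof.
split=> [[GG [T [[Phi lin] iso]]]|[[GG [T [tV tE iso]]] bal]].
  split; last exact: balanced_iso iso (linear_balanced lin).
  exists GG, T; split=> //; [exact: linear_vert_two_ended lin|exact: linear_edge_two_ended lin].
exists GG, T; split=> //; apply: balanced_linear_parametrization tV tE _.
exact: balanced_iso (isomorphic_sym iso) bal.
Qed.
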